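(* Let $G$ be a finite group, $H$ a subgroup of $G$ of index $2$, $p$ an odd prime number dividing $|G|$, and $\varepsilon:G\to\{-1,1\}$ the linear character of $G$ with kernel $H$. Let $\mathfrak B$ be a union of $p$-blocks of $G$ covering a union $\mathfrak b$ of $p$-blocks of $H$, where $\mathfrak b=\operatorname{Res}_H^G(\mathfrak B)$. Suppose that $\mathfrak B$ has a unitriangular $p$-basic set $(B,\leq,\Theta)$ such that $B$ is $\varepsilon$-stable (i.e. $\varepsilon\otimes\chi\in B$ for all $\chi\in B$) and the bijection $\Theta:B\to\operatorname{IBr}_p(\mathfrak B)$ is $\varepsilon$-equivariant (i.e. $\Theta(\varepsilon\otimes\chi)=\varepsilon\otimes\Theta(\chi)$ for all $\chi\in B$). Then $b=\operatorname{Res}_H^G(B)$ is a unitriangular $p$-basic set of $\mathfrak b$, i.e. there exist a total order on $\operatorname{Irr}(\mathfrak b)$ and a bijection $b\to\operatorname{IBr}_p(\mathfrak b)$ making $b$ a unitriangular $p$-basic set of $\mathfrak b$.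
   Context: Fix a $p$-modular system $(K,A,L)$ large enough for $G$ and its subgroups: $A$ is a valuation ring whose maximal ideal contains $p$, $K$ is its field of fractions (a splitting field), $L$ its residue field. $\operatorname{Irr}(X)$ is the set of ordinary irreducible characters of a finite group $X$, and $\operatorname{IBr}_p(X)$ the set of irreducible $p$-Brauer characters, extended by $0$ to $p$-singular elements. For $\chi\in\operatorname{Irr}(X)$, $\widehat\chi$ is the class function equal to $\chi$ on $p$-regular elements and to $0$ elsewhere, and the decomposition numbers $d_{\chi,\varphi}$ are defined by $\widehat\chi=\sum_{\varphi\in\operatorname{IBr}_p(X)}d_{\chi,\varphi}\varphi$. For a union $\mathfrak B$ of $p$-blocks, $\operatorname{Irr}(\mathfrak B)$ and $\operatorname{IBr}_p(\mathfrak B)$ are the sets of ordinary and Brauer irreducible characters in it. A unitriangular $p$-basic set of a union $\mathfrak B$ of $p$-blocks is a triple $(B,\leq,\Theta)$ where $B\subseteq\operatorname{Irr}(\mathfrak B)$, $\leq$ is a total order on $\operatorname{Irr}(\mathfrak B)$, and $\Theta:B\to\operatorname{IBr}_p(\mathfrak B)$ is a bijection such that $d_{\chi,\Theta(\chi)}=1$ for all $\chi\in B$, and for all $\varphi\in\operatorname{IBr}_p(\mathfrak B)$, $\chi\in\operatorname{Irr}(\mathfrak B)$, $d_{\chi,\varphi}=0$ unless $\chi\leq\Theta^{-1}(\varphi)$. $\operatorname{Res}_H^G(\mathfrak B)$ is the set of all irreducible constituents of the restrictions to $H$ of the characters in $\mathfrak B$; for $B\subseteq \operatorname{Irr}(G)$,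 $\operatorname{Res}_H^G(B)$ is the set of irreducible constituents of $\operatorname{Res}_H^G(\chi)$, $\chi\in B$. *)

(* Defs.v *)
From mathcomp Require Import all_boot all_order all_algebra all_fingroup.
From mathcomp Require Import pgroup mxrepresentation.
From mathcomp Require Import boolp classical_sets functions fsbigop.

Set Implicit Arguments.
Unset Strict Implicit.
Unset Printing Implicit Defensive.

Import Order.TTheory GRing.Theory.
Local Open Scope classical_set_scope.
Local Open Scope ring_scope.

(* A p-modular system (K, A, L). The ring A is a separate type, embedded in its
   field of fractions K; being a local ring, its maximal ideal consists of its
   non-units, and this is the kernel of the reduction map A -> L. Neither
   discreteness nor completeness of the valuation is assumed. *)
Record pmodular_system (p : nat) := PModularSystem {
  pmK : fieldType;
  pmA : idomainType;
  pmL : fieldType;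
  pm_emb : {rmorphism pmA -> pmK};
  pm_res : {rmorphism pmA -> pmL};
  pm_char0 : [pchar pmK] =i pred0;
  pm_emb_inj : injective pm_emb;
  pm_fraction : forall x : pmK,
    exists a b : pmA, b != 0 /\ x = pm_emb a / pm_emb b;
  pm_valuation : forall a b : pmA,
    (exists c, b = c * a) \/ (exists c, a = c * b);
  pm_res_surj : forall y : pmL, exists a, pm_res a = y;
  pm_res_ker : forall a : pmA, (pm_res a == 0) = (a \isn't a GRing.unit);
  pm_p_max : (p%:R : pmA) \isn't a GRing.unit
}.

Definition large_enough (p : nat) (M : pmodular_system p) (gT : finGroupType)
    (G : {group gT}) : Prop :=
  forall X : {group gT}, X \subset G ->
    group_splitting_field (pmK M) X /\ group_splitting_field (pmL M) X.

(* Ordinary and Brauer characters of a subgroup X of gT are K-valued functions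
   on gT that vanish outside X. *)
Notation cfunK M gT := {ffun gT -> pmK M}.
Notation cfunL M gT := {ffun gT -> pmL M}.

Definition affords (p : nat) (M : pmodular_system p) (gT : finGroupType)
    (X : {group gT}) (n : nat) (rX : mx_representation (pmK M) X n)
    (chi : cfunK M gT) : Prop :=
  chi = [ffun g => if g \in X then \tr (rX g) else 0].

Definition Irr (p : nat) (M : pmodular_system p) (gT : finGroupType)
    (X : {group gT}) : set (cfunK M gT) :=
  [set chi | exists (n : nat) (rX : mx_representation (pmK M) X n),
     mx_irreducible rX /\ affords rX chi].
Arguments Irr {p} M {gT} X.

(* The eigenvalues of rX g, for g p-regular, are the reductions of a unique
   family s of roots of unity of order prime to p in A; the value of the Brauer
   character at g is the sum of these lifts. *)
Definition affords_Brauer (p : nat) (M : pmodular_system p)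
    (gT : finGroupType) (X : {group gT}) (n : nat)
    (rX : mx_representation (pmL M) X n) (phi : cfunK M gT) : Prop :=
  (forall g, ~~ ((g \in X) && (p^'.-elt g)%g) -> phi g = 0) /\
  (forall g, g \in X -> (p^'.-elt g)%g ->
     exists s : seq (pmA M),
       [/\ forall a, a \in s -> a ^+ #[g]%g = 1,
           char_poly (rX g) = \prod_(a <- s) ('X - (pm_res M a)%:P) &
           phi g = pm_emb M (\sum_(a <- s) a)]).

Definition IBr (p : nat) (M : pmodular_system p) (gT : finGroupType)
    (X : {group gT}) : set (cfunK M gT) :=
  [set phi | exists (n : nat) (rX : mx_representation (pmL M) X n),
     mx_irreducible rX /\ affords_Brauer rX phi].
Arguments IBr {p} M {gT} X.

(* The coefficient of s in the expansion of f as a K-linear combination of the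
   family S. It is used for S = Irr(X) and S = IBr_p(X), which are finite and
   linearly independent, so that the choice made by xget is the only one. *)
Definition coefficient (p : nat) (M : pmodular_system p) (gT : finGroupType)
    (S : set (cfunK M gT)) (f s : cfunK M gT) : pmK M :=
  xget 0 [set k | exists c : cfunK M gT -> pmK M,
    (forall g, f g = \sum_(t \in S) c t * t g) /\ k = c s].

Definition pregular_part (p : nat) (M : pmodular_system p)
    (gT : finGroupType) (chi : cfunK M gT) : cfunK M gT :=
  [ffun g => if (p^'.-elt g)%g then chi g else 0].

Definition decomposition_number (p : nat) (M : pmodular_system p)
    (gT : finGroupType) (X : {group gT}) (chi phi : cfunK M gT) : pmK M :=
  coefficient (IBr M X) (pregular_part chi) phi.

Definition restrict (p : nat) (M : pmodular_system p) (gT : finGroupType)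
    (H : {group gT}) (chi : cfunK M gT) : cfunK M gT :=
  [ffun g => if g \in H then chi g else 0].

Definition Res_constituents (p : nat) (M : pmodular_system p)
    (gT : finGroupType) (H : {group gT}) (S : set (cfunK M gT)) :
    set (cfunK M gT) :=
  [set psi | Irr M H psi /\
     exists2 chi, S chi & coefficient (Irr M H) (restrict H chi) psi != 0].

(* A block is represented by its central character Z(LX) -> L, a function lam
   extended by 0 outside X, and a union of blocks by the set of its blocks.
   The value lam x is the image of the class sum of x ^: X. An ordinary chi
   lies in the block when lam is the reduction of |x ^: X| chi(x) / chi(1); a
   Brauer character does when the class sums act through lam. *)
Definition Irr_block (p : nat) (M : pmodular_system p) (gT : finGroupType)
    (X : {group gT}) (lam : cfunL M gT) : set (cfunK M gT) :=
  [set chi | Irr M X chi /\ forall x, x \in X -> exists a : pmA M,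
     pm_emb M a = #|(x ^: X)%g|%:R * chi x / chi 1%g /\ pm_res M a = lam x].

Definition IBr_block (p : nat) (M : pmodular_system p) (gT : finGroupType)
    (X : {group gT}) (lam : cfunL M gT) : set (cfunK M gT) :=
  [set phi | exists (n : nat) (rX : mx_representation (pmL M) X n),
     [/\ mx_irreducible rX, affords_Brauer rX phi &
         forall x, x \in X ->
           \sum_(y in (x ^: X)%g) rX y = (lam x)%:M]].

Definition pblocks (p : nat) (M : pmodular_system p) (gT : finGroupType)
    (X : {group gT}) : set (cfunL M gT) :=
  [set lam : cfunL M gT | (forall x, x \notin X -> lam x = 0) /\
             (exists chi, Irr_block X lam chi)].
Arguments pblocks {p} M {gT} X.

Definition Irr_blocks (p : nat) (M : pmodular_system p) (gT : finGroupType)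
    (X : {group gT}) (BB : set (cfunL M gT)) : set (cfunK M gT) :=
  \bigcup_(lam in BB) Irr_block X lam.

Definition IBr_blocks (p : nat) (M : pmodular_system p) (gT : finGroupType)
    (X : {group gT}) (BB : set (cfunL M gT)) : set (cfunK M gT) :=
  \bigcup_(lam in BB) IBr_block X lam.

Definition block_covers (p : nat) (M : pmodular_system p)
    (gT : finGroupType) (G H : {group gT}) (lam mu : cfunL M gT) : Prop :=
  exists psi, Irr_block H mu psi /\
    Res_constituents H (Irr_block G lam) psi.

Definition covers (p : nat) (M : pmodular_system p) (gT : finGroupType)
    (G H : {group gT}) (BB bb : set (cfunL M gT)) : Prop :=
  forall mu, bb mu -> exists2 lam, BB lam & block_covers G H lam mu.

Definition total_order_on (T : Type) (S : set T) (le : rel T) : Prop :=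
  [/\ {in S, reflexive le}, {in S &, antisymmetric le},
      {in S & &, transitive le} & {in S &, total le}].

(* Only the restrictions of le to Irr(BB) and of Theta to B matter. *)
Definition unitriangular_basic_set (p : nat) (M : pmodular_system p)
    (gT : finGroupType) (X : {group gT}) (BB : set (cfunL M gT))
    (B : set (cfunK M gT)) (le : rel (cfunK M gT))
    (Theta : cfunK M gT -> cfunK M gT) : Prop :=
  [/\ B `<=` Irr_blocks X BB,
      total_order_on (Irr_blocks X BB) le,
      set_bij B (IBr_blocks X BB) Theta,
      forall chi, B chi -> decomposition_number X chi (Theta chi) = 1 &
      forall phi chi chi', IBr_blocks X BB phi -> Irr_blocks X BB chi ->
        B chi' -> Theta chi' = phi ->
        ~~ le chi chi' -> decomposition_number X chi phi = 0].

Definition twist (p : nat) (M : pmodular_system p) (gT : finGroupType)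
    (eps : gT -> pmK M) (chi : cfunK M gT) : cfunK M gT :=
  [ffun g => eps g * chi g].

Definition sign_character (p : nat) (M : pmodular_system p)
    (gT : finGroupType) (G H : {group gT}) (eps : gT -> pmK M) : Prop :=
  [/\ forall g, g \in G -> eps g = 1 \/ eps g = -1,
      {in G &, forall x y, eps (x * y)%g = eps x * eps y} &
      forall g, g \in G -> (eps g == 1) = (g \in H)].

(* Main.v *)
Require Import Defs.
From mathcomp Require Import all_boot all_order all_algebra all_fingroup.
From mathcomp Require Import cyclic pgroup mxrepresentation.
From mathcomp Require Import boolp classical_sets functions fsbigop.

(** Let [t] be an element of [G] outside [H] and write [tw] for multiplication by
    [eps]. Clifford theory in index two is the same for ordinary and for Brauer
    characters: if [tw f <> f] then [f] restricts irreducibly to [H]; if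
    [tw f = f] then the restriction is [a + a^t] with [a^t <> a]; and two
    irreducible characters whose restrictions share a constituent agree up to
    [tw], because [f + tw f] is twice the restriction of [f], extended by zero
    ([Irr_splits], [IBr_splits], [constituent_eq]).

    Let [d] denote decomposition numbers. Restricting the [p]-regular part of an
    ordinary [chi] in two ways gives, for every Brauer character [a] of [H],
    that the sum of [d psi a] over the constituents [psi] of [chi] is the sum of
    [d chi phi] over the [phi] lying over [a], with multiplicity
    ([decomposition_restrict]). Take [chi] in [B] and [a] below [Theta chi]. The
    [phi] lying over [a] are [Theta chi] and [tw (Theta chi)], with
    [d chi (Theta chi) = 1]; if they differ then [d chi (tw (Theta chi)) = 0],
    as otherwise unitriangularity gives [chi <= tw chi] and, after twisting,
    [tw chi <= chi]. So the sum is [1]: decomposition numbers being natural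
    numbers, exactly one [psi] below [chi] contains [a], and it does so once
    ([B_below]). Conjugation by [t] shows that conversely each [psi] below [chi]
    contains exactly one [a] below [Theta chi] ([B_above]). This matching is the
    bijection for [H]. Ordering the characters of [H] by the smaller of the
    characters [chi] and [tw chi] above them makes it unitriangular
    ([leH_tri]).

    The argument needs decomposition numbers to be natural numbers and to
    respect blocks. A representation over [K] has an integral form
    ([integral_form]), whose reduction has the [p]-regular part of the character
    as its Brauer character and whose class sums act through the reduced central
    character ([Irr_decomposition]); and the irreducible Brauer characters are
    linearly independent ([IBr_free]). The Brauer characters in the blocks of
    [H] are those below the blocks of [G], since each of them occurs in the
    reduction of some ordinary character ([IBr_in_decomposition]) and ordinary
    and Brauer characters linked by a decomposition number belong to the same
    block ([block_link]). *)

Set Implicit Arguments.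
Unset Strict Implicit.
Unset Printing Implicit Defensive.

Import Order.TTheory GRing.Theory.
Local Open Scope classical_set_scope.
Local Open Scope ring_scope.

(** * Characteristic polynomials and composition factors *)

Lemma char_poly_sim (F : fieldType) n1 n2 (A : 'M[F]_n1) (B : 'M[F]_n2)
    (P : 'M_(n1, n2)) :
  n1 = n2 -> row_free P -> A *m P = P *m B -> char_poly A = char_poly B.
Proof.
move=> e; case: n2 / e in B P *; rewrite row_free_unit => uP eAB.
have -> : A = P *m B *m invmx P by rewrite -eAB mulmxK.
rewrite /char_poly; set u := map_mx polyC P.
have uu : u \in unitmx by rewrite map_unitmx.
have -> : char_poly_mx (P *m B *m invmx P) = u *m char_poly_mx B *m invmx u.
  rewrite /char_poly_mx mulmxBr mulmxBl scalar_mxC mulmxK //.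
  by rewrite !map_mxM /= map_invmx.
by rewrite !det_mulmx mulrAC -det_mulmx mulmxV // det1 mul1r.
Qed.

Lemma char_poly_lblock (R : comNzRingType) m n (A : 'M[R]_m) C (D : 'M[R]_n) :
  char_poly (block_mx A 0 C D) = char_poly A * char_poly D.
Proof.
rewrite /char_poly; have -> : char_poly_mx (block_mx A 0 C D) =
  block_mx (char_poly_mx A) 0 (- map_mx polyC C) (char_poly_mx D).
  rewrite /char_poly_mx scalar_mx_block map_block_mx opp_block_mx add_block_mx.
  by rewrite map_mx0 oppr0 addr0 add0r.
by rewrite det_lblock.
Qed.

Lemma eq_char_poly_trace (F : fieldType) n1 n2 (B : 'M[F]_n1) (D : 'M[F]_n2) :
  char_poly B = char_poly D -> \tr B = \tr D.
Proof.
move=> e; have n12 : n1 = n2.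
  by have := size_char_poly B; rewrite e size_char_poly => -[].
case: n2 / n12 in D e *; case: n1 => [|n] in B D e *;
  first by rewrite /mxtrace !big_ord0.
by apply: oppr_inj; rewrite -!char_poly_trace // e.
Qed.

(** Negating a matrix substitutes [-X] in its characteristic polynomial, up to a
    sign. *)
Lemma char_polyN (F : fieldType) n (B : 'M[F]_n) (s : seq F) :
  char_poly B = \prod_(a <- s) ('X - a%:P) ->
    char_poly (- B) = \prod_(a <- s) ('X - (- a)%:P).
Proof.
move=> e; have ss : size s = n.
  by have := size_char_poly B; rewrite e size_prod_XsubC => -[].
have : char_poly B \Po (- 'X) = (-1) ^+ n * char_poly (- B).
  have := det_map_mx (comp_poly (- 'X : {poly F})) (char_poly_mx B); rewrite /= => <-.
  rewrite -detZ; congr (\det _); apply/matrixP => i j.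
  rewrite !mxE /= comp_polyB comp_polyC -scaler_nat comp_polyZ comp_polyX polyCN opprK.
  by rewrite mulN1r opprD scalerN.
have -> : char_poly B \Po (- 'X) = (-1) ^+ n * \prod_(a <- s) ('X - (- a)%:P).
  rewrite e -ss; elim: s {e ss} => [|a s IH];
    first by rewrite !big_nil comp_polyC mul1r.
  rewrite !big_cons comp_polyM IH comp_polyB comp_polyX comp_polyC /= exprS polyCN
    opprK.
  by rewrite -opprD -mulrA mulN1r mulrCA -mulrN -mulNr.
by move/(mulfI _) => -> //; rewrite expf_neq0 // oppr_eq0 oner_eq0.
Qed.

Section FieldRep.

Variables (F : fieldType) (gT : finGroupType).
Implicit Types (G : {group gT}).

Lemma char_poly_rsim G n1 n2 (r1 : mx_representation F G n1)
    (r2 : mx_representation F G n2) x :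
  mx_rsim r1 r2 -> x \in G -> char_poly (r1 x) = char_poly (r2 x).
Proof. by case=> B e Bf h xG; apply: (char_poly_sim e Bf); apply: h. Qed.

Lemma char_poly_sub_fact G n (rG : mx_representation F G n) (U : 'M_n)
    (Umod : mxmodule rG U) x :
  x \in G -> char_poly (rG x) =
    char_poly (submod_repr Umod x) * char_poly (factmod_repr Umod x).
Proof.
move=> xG; rewrite -(char_poly_lblock _
  (in_submod U (val_factmod 1%:M *m rG x))).
pose P : 'M_(_, n) := col_mx (@val_submod _ _ U _ 1%:M) (@val_factmod _ _ U _ 1%:M).
apply: esym; apply: (@char_poly_sim _ _ _ _ _ P).
- by rewrite mxrank_coker subnKC // rank_leq_row.
- apply/row_freeP; exists (row_mx (in_submod U 1%:M) (in_factmod U 1%:M)).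
  rewrite mul_col_row -!in_submodE -!in_factmodE val_submodK val_factmodK.
  have -> : in_submod U (val_factmod (1%:M : 'M_(\rank (cokermx U)))) = 0.
    by apply/eqP; rewrite in_submod_eq0 val_factmodP.
  have -> : in_factmod U (val_submod (1%:M : 'M_(\rank U))) = 0.
    by apply/eqP; rewrite in_factmod_eq0 val_submodP.
  by rewrite -scalar_mx_block.
rewrite mul_block_col mul_col_mx mul0mx addr0 -!val_submodE -!val_factmodE.
congr col_mx; first by rewrite -[submod_repr _ _]mul1mx val_submodJ.
rewrite -{2}[val_factmod 1%:M *m rG x](add_sub_fact_mod U); congr (_ + _).
Qed.

(** Induction over the composition factors, for properties that pass from a
    submodule and its quotient to the whole module. *)
Lemma repr_ind G (P : forall n, mx_representation F G n -> Prop) :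
    (forall rG, P 0%N rG) ->
    (forall n rG, mx_irreducible rG -> P n rG) ->
    (forall n rG (U : 'M_n) (Umod : mxmodule rG U),
       P _ (submod_repr Umod) -> P _ (factmod_repr Umod) -> P n rG) ->
  forall n rG, P n rG.
Proof.
move=> P0 Pirr Pext n; have [m] := ubnP n; elim: m n => // m IH [|n] // ltnm rG.
have [|nirr] := pselect (mx_irreducible rG); first exact: Pirr.
have [U [Umod nzU nfU]] : exists U : 'M_n.+1, [/\ mxmodule rG U, U != 0 &
  ~~ row_full U].
  apply: contrapT => nU; apply/nirr/mx_irrP; split=> // U Umod nzU.
  by apply: contrapT => /negP nf; apply: nU; exists U; split.
have ltm r : (r < n.+1)%N -> (r < m)%N by move=> /leq_trans; apply; rewrite -ltnS.
apply: (Pext _ _ U Umod); apply: IH; apply: ltm; rewrite ?mxrank_coker.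
  by rewrite ltn_neqAle nfU rank_leq_row.
by rewrite ltn_subrL lt0n mxrank_eq0 nzU.
Qed.

(** Irreducible representations of an abelian group over a splitting field have
    degree one, hence the composition factors give simultaneous eigenvalues. *)
Lemma char_poly_abelian (C : {group gT}) n (rC : mx_representation F C n) :
    group_splitting_field F C -> abelian C ->
  exists s : seq {ffun gT -> F},
    (forall l, l \in s -> l 1%g = 1 /\ {in C &, {morph l : x y / (x * y)%g >-> x * y}})
    /\ {in C, forall x, char_poly (rC x) = \prod_(l <- s) ('X - (l x)%:P)}.
Proof.
move=> splitC cCC; elim/repr_ind: n / rC => [rC|n rC irr|n rC U Umod].
- exists [::]; split=> // x _; rewrite big_nil /char_poly det_mx00 //.
- have n1 : n = 1%N by apply: mx_irr_abelian_linear irr cCC.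
  move: rC irr; rewrite {}n1 => rC _; exists [:: [ffun x => rC x 0 0]]; split.
    move=> l /[!inE] /eqP->; rewrite ffunE repr_mx1 mxE eqxx; split=> // x y xC yC.
    by rewrite !ffunE repr_mxM // mxE big_ord1.
  by move=> x _; rewrite big_seq1 /char_poly det_mx11 !mxE ffunE.
move=> [s1 [h1 e1]] [s2 [h2 e2]]; exists (s1 ++ s2); split=> [l|x xC].
  by rewrite mem_cat => /orP[/h1|/h2].
by rewrite (char_poly_sub_fact Umod xC) e1 // e2 // big_cat.
Qed.

End FieldRep.

(** * Linear independence of irreducible traces *)

Section Traces.

Variables (F : fieldType) (gT : finGroupType) (G : {group gT}).
Local Notation aG := (regular_repr F G).

Lemma gring_mx_onto n (rG : mx_representation F G n) :
  mx_absolutely_irreducible rG ->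
  forall A, gring_mx rG (mxvec A *m pinvmx (enveloping_algebra_mx rG)) = A.
Proof.
case/andP=> _ fE A; rewrite /gring_mx /= mulmxKpV ?mxvecK //.
by rewrite submx_full.
Qed.

Lemma gring_mx_sum n (rG : mx_representation F G n) u :
  gring_mx rG u = \sum_i u 0 i *: rG (enum_val i).
Proof.
rewrite /gring_mx /= mulmx_sum_row linear_sum; apply: eq_bigr => i _.
by rewrite linearZ /= rowK mxvecK.
Qed.

Lemma gring_mx_elt n (rG : mx_representation F G n) g :
  g \in G -> gring_mx rG (gring_row (aG g)) = rG g.
Proof. by move=> gG; rewrite -gring_opE gring_opG. Qed.

Lemma delta_mul_delta n (M : 'M[F]_n) (i j k l : 'I_n) :
  delta_mx k i *m M *m delta_mx j l = M i j *: delta_mx k l :> 'M_n.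
Proof.
apply/matrixP => a b; rewrite [LHS]mxE (bigD1 j) //= big1 => [|c /negbTE nc].
  rewrite [X in X * _]mxE (bigD1 i) //= big1 => [|c /negbTE nc].
    by rewrite !mxE !addr0 !eqxx andbT /= mulrAC mulrC -natrM mulnb.
  by rewrite mxE nc andbF mul0r.
by rewrite [X in _ * X]mxE nc mulr0.
Qed.

(** The product of the group algebra on coefficient vectors. *)
Definition gring_mul (a b : 'rV[F]_#|G|) : 'rV_#|G| := a *m gring_mx aG b.

Lemma gring_mulE n (rG : mx_representation F G n) (a b : 'rV_#|G|) :
  gring_mx rG (gring_mul a b) = gring_mx rG a *m gring_mx rG b.
Proof. exact: gring_mxA. Qed.

(** If the kernel of [r2] in the group algebra is not contained in that of [r1],
    its image under [r1] is a nonzero ideal of a matrix algebra, hence contains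
    [1]. Otherwise [r1] factors as [Phi] through [r2], and a nonzero row of the
    image of an elementary matrix under [Phi] yields an intertwiner, which is an
    isomorphism by irreducibility. *)
Lemma gring_separate n1 n2 (r1 : mx_representation F G n1)
    (r2 : mx_representation F G n2) :
    mx_absolutely_irreducible r1 -> mx_absolutely_irreducible r2 ->
    ~ mx_rsim r2 r1 ->
  exists u, gring_mx r1 u = 1%:M /\ gring_mx r2 u = 0.
Proof.
move=> abs1 abs2 nsim; have [n1_gt0 _] := andP abs1; have [n2_gt0 _] := andP abs2.
pose L1 A := mxvec A *m pinvmx (enveloping_algebra_mx r1).
pose L2 A := mxvec A *m pinvmx (enveloping_algebra_mx r2).
have L1K A : gring_mx r1 (L1 A) = A by apply: gring_mx_onto.
have L2K A : gring_mx r2 (L2 A) = A by apply: gring_mx_onto.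
have [[u u2 u1]|sub] := pselect (exists2 u, gring_mx r2 u = 0 & gring_mx r1 u != 0).
  have [i [j nzij]] : exists i j, gring_mx r1 u i j != 0.
    apply: contrapT => nz; case/eqP: u1; apply/matrixP => i j; rewrite [RHS]mxE.
    by apply/eqP; apply: contrapT => /negP h; apply: nz; exists i, j.
  pose v k := gring_mul
    (gring_mul (L1 ((gring_mx r1 u i j)^-1 *: delta_mx k i)) u) (L1 (delta_mx j k)).
  exists (\sum_k v k); rewrite !linear_sum; split; last first.
    by rewrite big1 // => k _; rewrite /v /= !gring_mulE u2 mulmx0 mul0mx.
  rewrite mx1_sum_delta; apply: eq_bigr => k _; rewrite /v /= !gring_mulE !L1K.
  by rewrite -!scalemxAl delta_mul_delta scalerA mulVf ?scale1r.
case: nsim; pose Phi A := gring_mx r1 (L2 A).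
have PhiE u : Phi (gring_mx r2 u) = gring_mx r1 u.
  apply/eqP; rewrite -subr_eq0 /Phi -linearB; apply: contrapT => /negP nz.
  by apply: sub; exists (L2 (gring_mx r2 u) - u); rewrite // linearB /= L2K subrr.
have PhiM A B : Phi (A *m B) = Phi A *m Phi B.
  by rewrite -[in LHS](L2K A) -[in LHS](L2K B) -gring_mulE PhiE gring_mulE.
have PhiG g : g \in G -> Phi (r2 g) = r1 g.
  by move=> gG; rewrite -(gring_mx_elt r2) // PhiE gring_mx_elt.
have Phi_lin a A B : Phi (a *: A + B) = a *: Phi A + Phi B.
  by rewrite /Phi /L2 linearP mulmxDl -scalemxAl linearP.
have Phi0 : Phi 0 = 0 by rewrite /Phi /L2 linear0 mul0mx linear0.
have Phi_sum (I : finType) (c : I -> F) (A : I -> 'M_n2) :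
    Phi (\sum_k c k *: A k) = \sum_k c k *: Phi (A k).
  elim/big_rec2: _ => [//|k y1 y2 _ <-]; exact: Phi_lin.
(* [Phi] is a unital morphism on a matrix algebra, so it kills no elementary
   matrix. *)
pose o := Ordinal n2_gt0.
have nz00 : Phi (delta_mx o o) != 0.
  apply/eqP => z; have /eqP := PhiG 1%g (group1 G); rewrite !repr_mx1.
  rewrite mx1_sum_delta (eq_bigr (fun k => 1 *: delta_mx k k)); last first.
    by move=> k _; rewrite scale1r.
  rewrite Phi_sum big1 => [|k _]; last first.
    by rewrite -(mul_delta_mx o) -[delta_mx o k](mul_delta_mx o) !PhiM z mul0mx mulmx0
      scaler0.
  rewrite eq_sym => /eqP/matrixP/(_ (Ordinal n1_gt0) (Ordinal n1_gt0)).
  by rewrite !mxE eqxx => /eqP; rewrite oner_eq0.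
have [i nzi] : exists i, row i (Phi (delta_mx o o)) != 0.
  apply: contrapT => nz; case/eqP: nz00; apply/row_matrixP => i; rewrite row0.
  by apply/eqP; apply: contrapT => /negP h; apply: nz; exists i.
pose T := \matrix_(k < n2) row i (Phi (delta_mx o k)).
have TG g : g \in G -> r2 g *m T = T *m r1 g.
  move=> gG; apply/row_matrixP => k;
    rewrite !row_mul rowK -[in RHS]PhiG // -[in RHS]row_mul -PhiM.
  have -> : delta_mx o k *m r2 g = \sum_l r2 g k l *: delta_mx o l.
    apply/matrixP => a b; rewrite !mxE (bigD1 k) //= big1 => [|l /negbTE nl];
      last first.
      by rewrite !mxE nl andbF mul0r.
    rewrite addr0 summxE (bigD1 b) //= big1 => [|l /negbTE nl]; last first.
      by rewrite !mxE [b == l]eq_sym nl andbF mulr0.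
    by rewrite !mxE !eqxx addr0 andbT mulrC.
  rewrite Phi_sum mulmx_sum_row linear_sum; apply: eq_bigr => l _.
  by rewrite linearZ /= rowK !mxE.
have nzT : T != 0.
  apply: contraNneq nzi => T0; have := rowK (fun k => row i (Phi (delta_mx o k))) o.
  by rewrite -/T T0 row0 => <-.
have /mx_irrP[_ irr1] := mx_abs_irrW abs1; have /mx_irrP[_ irr2] := mx_abs_irrW abs2.
have fT : row_full <<T>>%MS.
  apply: irr1; last by rewrite (eqmx_eq0 (genmxE T)).
  rewrite (eqmx_module _ (genmxE T)); apply/mxmoduleP => g gG.
  by rewrite -TG // submxMl.
have kT : kermx T = 0.
  apply/eqP; apply: contrapT => /negP nz.
  have kmod : mxmodule r2 (kermx T).
    by apply/mxmoduleP => g gG; apply/sub_kermxP;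
      rewrite -mulmxA TG // mulmxA mulmx_ker mul0mx.
  have /row_fullP[Q QK] := irr2 _ kmod nz; case/eqP: nzT.
  by have := mulmx_ker T => /(congr1 (mulmx Q)); rewrite mulmxA QK mul1mx mulmx0.
have ffT : row_free T by rewrite -kermx_eq0 kT.
exists T => //.
by rewrite -(eqP ffT); move: fT; rewrite /row_full mxrank_gen => /eqP.
Qed.

(** Multiplying the separating elements gives an element of the group algebra
    that acts as the identity for one index and as zero for all the others; this
    holds in any characteristic. *)
Lemma irr_trace_free (I : finType) (d : I -> nat)
    (r : forall i, mx_representation F G (d i)) (c : I -> F) :
    (forall i, mx_absolutely_irreducible (r i)) ->
    (forall i j, i != j -> ~ mx_rsim (r i) (r j)) ->
    {in G, forall g, \sum_i c i * \tr (r i g) = 0} ->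
  forall i, c i = 0.
Proof.
move=> absr nsim rel i.
have rel_alg u : \sum_j c j * \tr (gring_mx (r j) u) = 0.
  rewrite (eq_bigr (fun j => \sum_k u 0 k * (c j * \tr (r j (enum_val k)))));
    last first.
    move=> j _; rewrite gring_mx_sum linear_sum mulr_sumr; apply: eq_bigr => k _.
    by rewrite linearZ /= mulrCA.
  rewrite exchange_big big1 //= => k _.
  by rewrite -mulr_sumr rel ?mulr0 // enum_valP.
have [u [u1 u0]] : exists u, gring_mx (r i) u = 1%:M /\
    forall j, j \in enum I -> j != i -> gring_mx (r j) u = 0.
  elim: (enum I) => [|j s [u [u1 u0]]].
    exists (gring_row (aG 1%g)); split=> //.
    by rewrite gring_mx_elt // repr_mx1.
  have [->|ji] := eqVneq j i.
    exists u; split=> // k; rewrite inE => /orP[/eqP->|]; last exact: u0.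
    by rewrite eqxx.
  have [v [v1 v0]] := gring_separate (absr i) (absr j) (nsim _ _ ji).
  exists (gring_mul u v); split=> [|k]; rewrite ?gring_mulE ?u1 ?v1 ?mul1mx //.
  rewrite inE => /orP[/eqP-> _|ks ki]; first by rewrite v0 mulmx0.
  by rewrite u0 // mul0mx.
have [di_gt0 _] := andP (absr i); pose o := Ordinal di_gt0.
pose e := mxvec (delta_mx o o) *m pinvmx (enveloping_algebra_mx (r i)).
have := rel_alg (gring_mul u e); rewrite (bigD1 i) //= big1 => [|j ji].
  rewrite addr0 gring_mulE u1 mul1mx gring_mx_onto // => h.
  rewrite -h /mxtrace (bigD1 o) //= big1 ?mxE ?eqxx ?addr0 ?mulr1 // => k /negbTE ko.
  by rewrite mxE ko.
by rewrite gring_mulE u0 ?mul0mx ?linear0 ?mulr0 // mem_enum.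
Qed.

Lemma abs_irr_trace_neq0 n (rG : mx_representation F G n) :
  mx_absolutely_irreducible rG -> exists2 g, g \in G & \tr (rG g) != 0.
Proof.
move=> absG; apply: contrapT => nz.
have := @irr_trace_free unit (fun=> n) (fun=> rG) (fun=> 1) (fun=> absG).
move=> /(_ _ _ tt)/eqP; rewrite oner_eq0; case/(_ _ _)/notF.
  by case=> -[].
move=> g gG; rewrite (big_pred1 tt) => [|[] //]; rewrite mul1r; apply/eqP;
  apply: contrapT => /negP h.
by apply: nz; exists g.
Qed.

End Traces.

(** * Clifford theory in index two *)

Section ConjTwist.

Variables (F : fieldType) (gT : finGroupType).

Lemma conj_mx_repr (H : {group gT}) t n (rH : mx_representation F H n) :
  (t \in 'N(H))%g -> mx_repr H (fun h => rH (h ^ t^-1)%g).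
Proof.
move=> nHt; split=> [|x y xH yH]; first by rewrite conj1g repr_mx1.
by rewrite conjMg repr_mxM // memJ_norm // groupV.
Qed.

Definition conj_repr (H : {group gT}) t (nHt : (t \in 'N(H))%g) n
    (rH : mx_representation F H n) :=
  MxRepresentation (conj_mx_repr rH nHt).

Lemma conj_repr_irr (H : {group gT}) t (nHt : (t \in 'N(H))%g) n
    (rH : mx_representation F H n) :
  mx_irreducible rH -> mx_irreducible (conj_repr nHt rH).
Proof.
move=> /mx_irrP[n0 irr]; apply/mx_irrP; split=> // U /mxmoduleP Umod.
apply: irr; apply/mxmoduleP => x xH.
by have := Umod (x ^ t)%g; rewrite /= conjgK memJ_norm //; apply.
Qed.

Lemma twist_mx_repr (G : {group gT}) (e : gT -> F) n (rG : mx_representation F G n) :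
    e 1%g = 1 -> {in G &, {morph e : x y / (x * y)%g >-> x * y}} ->
  mx_repr G (fun g => e g *: rG g).
Proof.
move=> e1 eM; split=> [|x y xG yG]; first by rewrite e1 scale1r repr_mx1.
by rewrite eM // repr_mxM // -scalemxAl -scalemxAr scalerA.
Qed.

Definition twist_repr (G : {group gT}) (e : gT -> F) (e1 : e 1%g = 1)
    (eM : {in G &, {morph e : x y / (x * y)%g >-> x * y}}) n
    (rG : mx_representation F G n) :=
  MxRepresentation (twist_mx_repr rG e1 eM).

Lemma twist_repr_irr (G : {group gT}) (e : gT -> F) (e1 : e 1%g = 1)
    (eM : {in G &, {morph e : x y / (x * y)%g >-> x * y}}) n
    (rG : mx_representation F G n) :
  mx_irreducible rG -> mx_irreducible (twist_repr e1 eM rG).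
Proof.
move=> /mx_irrP[n0 irr]; apply/mx_irrP; split=> // U /mxmoduleP Umod.
apply: irr; apply/mxmoduleP => x xG.
have ux : e x != 0.
  apply/eqP => ex; have := eM x x^-1%g xG;
    rewrite groupV ex mul0r mulgV e1 => /(_ xG)/eqP.
  by rewrite oner_eq0.
by have := Umod x xG; rewrite /= -scalemxAr (eqmx_scale _ ux).
Qed.

End ConjTwist.

Section IndexTwo.

Variables (F : fieldType) (gT : finGroupType) (G H : {group gT}) (t : gT).
Hypotheses (sHG : H \subset G) (iHG : #|G : H|%g = 2%N).
Hypotheses (tG : t \in G) (tH : t \notin H).

Lemma index2_norm : (t \in 'N(H))%g.
Proof. by have /andP[_ /fintype.subsetP] := index2_normal sHG iHG; apply. Qed.

Lemma index2_coset x : x \in G -> x \notin H -> (x * t^-1)%g \in H.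
Proof.
move=> xG xH; have : x \in (H :* t)%g by rewrite (rcoset_index2 sHG iHG) !inE ?tG ?tH
  ?xH.
by rewrite mem_rcoset.
Qed.

Lemma index2_decomp x : x \in G -> exists2 h, h \in H & x = h \/ x = (h * t)%g.
Proof.
move=> xG; have [xH|xH] := boolP (x \in H); first by exists x; [|left].
by exists (x * t^-1)%g; [exact: index2_coset|right; rewrite mulgKV].
Qed.

Lemma index2_sqr : (t * t)%g \in H.
Proof.
have := @index2_coset t^-1%g; rewrite groupV groupV -invMg groupV; exact.
Qed.

Lemma index2_notin h : h \in H -> (h * t)%g \notin H.
Proof. by move=> hH; rewrite groupMl. Qed.

Lemma index2_sum (V : zmodType) (f : gT -> V) :
  \sum_(g in G) f g = \sum_(h in H) f h + \sum_(h in H) f (h * t)%g.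
Proof.
rewrite (bigID (fun g => g \in H)) /=; congr (_ + _).
  by apply: eq_bigl => g; rewrite andb_idl // => /(fintype.subsetP sHG).
rewrite (reindex_inj (mulIg t)) /=; apply: eq_bigl => h.
apply/andP/idP => [[htG htH]|hH]; first by rewrite -(mulgK t h) index2_coset.
by rewrite index2_notin // groupM // (fintype.subsetP sHG).
Qed.

Variables (n : nat) (rG : mx_representation F G n).
Hypothesis irrG : mx_irreducible rG.
Local Notation rH := (subg_repr rG sHG).

(** If [U] is a simple [H]-submodule then [U + U t] is [G]-stable, hence
    everything; so either [U] is already everything or the sum is direct and
    [t] exchanges the two summands. *)
Lemma Clifford_index2 :
  mx_irreducible rH \/
  exists m (a : mx_representation F H m) (P : 'M_(m + m, n)) (c : 'M_m),
    [/\ mx_irreducible a, (m + m)%N = n, row_free P,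
        {in H, forall h, block_mx (a h) 0 0 (a (h ^ t^-1)%g) *m P = P *m rG h} &
        block_mx 0 1%:M c 0 *m P = P *m rG t].
Proof.
have [U simU] : exists U, mxsimple rH U.
  apply: contrapT => nU; suff: false by [].
  have [_ nz _] := irrG; apply: (mxsimple_exists (mxmodule1 rH) nz) => -[U simU _].
  by case: nU; exists U.
have [modU nzU minU] := simU.
have [fU|nfU] := boolP (row_full U).
  left; apply: mx_rsim_irr ((submod_mx_irr modU).2 simU).
  apply: rsim_submod1; apply/eqmxP.
  by rewrite submx1 sub1mx.
right; pose B := @val_submod _ _ U _ 1%:M; pose a := submod_repr modU.
pose P := col_mx B (B *m rG t).
have Ba h : h \in H -> a h *m B = B *m rG h.
  by move=> hH; rewrite /B -val_submodE -[a h]mul1mx val_submodJ.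
have nHt := index2_norm.
have PH h : h \in H -> block_mx (a h) 0 0 (a (h ^ t^-1)%g) *m P = P *m rG h.
  move=> hH; rewrite mul_block_col !mul0mx addr0 add0r mul_col_mx Ba //.
  have htH : (h ^ t^-1)%g \in H by rewrite memJ_norm // groupV.
  have [hG htG] := (fintype.subsetP sHG _ hH, fintype.subsetP sHG _ htH).
  rewrite mulmxA Ba // -!mulmxA -!repr_mxM //.
  by rewrite (conjgCV t h).
have Pt : block_mx 0 1%:M (a (t * t)%g) 0 *m P = P *m rG t.
  rewrite mul_block_col !mul0mx add0r addr0 mul1mx mul_col_mx Ba ?index2_sqr //.
  by rewrite repr_mxM // mulmxA.
have modP : mxmodule rG <<P>>%MS.
  rewrite (eqmx_module _ (genmxE P)); apply/mxmoduleP => g gG.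
  have [k kH [->|->]] := index2_decomp gG.
    by rewrite -PH // submxMl.
  have kG := fintype.subsetP sHG _ kH;
    rewrite repr_mxM // mulmxA -PH // -mulmxA -Pt mulmxA.
  exact: submxMl.
have BU : (B :=: U)%MS := val_submod1 U.
have PE : (P :=: U + U *m rG t)%MS.
  by apply: eqmx_trans (eqmx_sym (addsmxE _ _)) _; apply: adds_eqmx (eqmxMr _ _).
have nzP : (<<P>> != 0)%MS.
  rewrite (eqmx_eq0 (genmxE P)) (eqmx_eq0 PE); apply: contra nzU.
  by rewrite -!submx0; apply: submx_trans; rewrite addsmxSl.
have fP : row_full P.
  by have [_ /(_ _ modP nzP)] := (mx_irrP rG).1 irrG; rewrite /row_full mxrank_gen.
have UIt : (U :&: U *m rG t)%MS = 0.
  apply/eqP; apply: contrapT => /negP nzI.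
  have modUt : mxmodule rH (U *m rG t).
    by have [] := @Clifford_simple _ _ _ _ (index2_normal sHG iHG) _ rG U t simU tG.
  have sUt : (U <= U *m rG t)%MS.
    apply: submx_trans (minU _ _ _ nzI) (capmxSr _ _); last exact: capmxSl.
    exact: capmx_module.
  have eUt : (U *m rG t <= U)%MS.
    by rewrite -(geq_leqif (mxrank_leqif_sup sUt)) mxrankMfree // repr_mx_free.
  case/negP: nfU; rewrite -sub1mx; move: fP; rewrite -sub1mx PE.
  by move/submx_trans; apply; rewrite addsmx_sub submx_refl.
have rP : \rank P = (\rank U + \rank U)%N.
  rewrite PE; have := mxrank_sum_cap U (U *m rG t); rewrite UIt mxrank0 addn0 => ->.
  by rewrite mxrankMfree // repr_mx_free.
exists (\rank U), a, P, (a (t * t)%g); split=> //.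
- exact/(submod_mx_irr modU).
- by rewrite -rP; move: fP => /eqP.
- by rewrite /row_free rP.
Qed.

(** An absolutely irreducible restriction to [H] already spans the full matrix
    algebra, and so does its translate by [t]; the trace does not vanish on it. *)
Lemma irr_restr_trace_neq0 :
  mx_absolutely_irreducible rH -> exists g, [/\ g \in G, g \notin H & \tr (rG g) != 0].
Proof.
case/mx_abs_irrP=> n_gt0 [x spanH]; apply: contrapT => nz.
have trt h : h \in H -> \tr (rG (h * t)%g) = 0.
  move=> hH; apply/eqP; apply: contrapT => /negP nzt; case: nz; exists (h * t)%g.
  by rewrite index2_notin // groupM // (fintype.subsetP sHG).
pose o := Ordinal n_gt0; pose e : 'M[F]_n := delta_mx o o.
have : \tr (e *m rG t^-1%g *m rG t) = 0.
  rewrite [e *m _]spanH mulmx_suml linear_sum big1 //= => h hH.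
  by rewrite -scalemxAl linearZ /= -repr_mxM ?(fintype.subsetP sHG _ hH) // trt ?mulr0.
rewrite -mulmxA -repr_mxM ?groupV // mulVg repr_mx1 mulmx1 => /eqP.
rewrite /mxtrace (bigD1 o) //= big1 ?mxE ?eqxx ?addr0 ?oner_eq0 // => k /negbTE ko.
by rewrite mxE ko.
Qed.

(** If the two constituents [a] and [a^t] of the restriction had the same
    trace function, then the elements of the group algebra of [H] would act on
    both with the same traces; but absolute irreducibility of [rG] provides an
    element acting as the identity on one and as zero on the other. *)
Lemma index2_conj_trace m (a : mx_representation F H m) (P : 'M_(m + m, n)) c :
    mx_absolutely_irreducible rG -> mx_absolutely_irreducible a ->
    (m + m)%N = n -> row_free P ->
    {in H, forall h, block_mx (a h) 0 0 (a (h ^ t^-1)%g) *m P = P *m rG h} ->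
    block_mx 0 1%:M c 0 *m P = P *m rG t ->
  exists2 h, h \in H & \tr (a h) != \tr (a (h ^ t^-1)%g).
Proof.
move=> absG absa mn freeP PH Pt.
have [k kH nzk] := abs_irr_trace_neq0 absa; apply: contrapT => eqtr.
have tr_eq h : h \in H -> \tr (a h) = \tr (a (h ^ t^-1)%g).
  move=> hH; apply/eqP; apply: contrapT => /negP h_neq; apply: eqtr; exists h => //.
have [Q PQ] := row_freeP freeP.
have [_ [x_ spanG]] := mx_abs_irrP absG.
pose e : 'M[F]_(m + m) := block_mx 1%:M 0 0 0; pose x g := x_ g (Q *m e *m P).
have HG := fintype.subsetP sHG; have nHt := index2_norm.
pose a' h := a (h ^ t^-1)%g.
have PG : e = \sum_(h in H) x h *: block_mx (a h) 0 0 (a' h)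
     + \sum_(h in H) x (h * t)%g *: (block_mx (a h) 0 0 (a' h) *m block_mx 0 1%:M c 0).
  rewrite -[e]mulmx1 -PQ mulmxA -[e *m P]mul1mx -PQ.
  rewrite -[P *m Q *m (e *m P)]mulmxA [Q *m _]mulmxA [Q *m e *m P]spanG index2_sum.
  rewrite mulmxDr mulmxDl; congr (_ + _); rewrite mulmx_sumr mulmx_suml.
    apply: eq_bigr => h hH; rewrite -scalemxAr -scalemxAl; congr (_ *: _).
    by rewrite -PH // -mulmxA PQ mulmx1.
  apply: eq_bigr => h hH; rewrite -scalemxAr -scalemxAl; congr (_ *: _).
  by rewrite repr_mxM ?(HG _ hH) // mulmxA -PH // -[_ *m P *m _]mulmxA -Pt -!mulmxA PQ
    mulmx1.
have PG' : e = block_mx (\sum_(h in H) x h *: a h) (\sum_(h in H) x (h * t)%g *: a h)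
    (\sum_(h in H) x (h * t)%g *: (a' h *m c)) (\sum_(h in H) x h *: a' h).
  rewrite PG; transitivity (
    block_mx (\sum_(h in H) x h *: a h) 0 0 (\sum_(h in H) x h *: a' h) +
    block_mx 0 (\sum_(h in H) x (h * t)%g *: a h) (\sum_(h in H) x (h * t)%g *: (a' h
      *m c)) 0).
    congr (_ + _).
      elim/big_rec3: _ => [|h A B C _ ->]; first by rewrite block_mx0.
      by rewrite scale_block_mx !scaler0 add_block_mx !addr0.
    elim/big_rec3: _ => [|h A B C _ ->]; first by rewrite block_mx0.
    rewrite mulmx_block !mul0mx !mulmx0 !addr0 !add0r mulmx1.
    by rewrite scale_block_mx !scaler0 add_block_mx !addr0.
  by rewrite add_block_mx !addr0 !add0r.
have [e1 _ _ e0] := eq_block_mx PG'.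
case/eqP: nzk; rewrite -[a k]mul1mx e1 mulmx_suml linear_sum /=.
transitivity (\tr (\sum_(h in H) x h *: (a' h *m a' k))).
  rewrite linear_sum; apply: eq_bigr => h hH; rewrite -scalemxAl !linearZ /=;
    congr (_ * _).
  rewrite -!repr_mxM ?memJ_norm ?groupV // tr_eq ?groupM //.
  by rewrite conjMg.
rewrite (eq_bigr (fun h => (x h *: a' h) *m a' k)) => [|h _]; last by rewrite scalemxAl.
by rewrite -mulmx_suml -e0 mul0mx linear0.
Qed.

Lemma index2_antidiag m (a : mx_representation F H m) (P : 'M_(m + m, n)) c :
    (m + m)%N = n -> row_free P ->
    {in H, forall h, block_mx (a h) 0 0 (a (h ^ t^-1)%g) *m P = P *m rG h} ->
    block_mx 0 1%:M c 0 *m P = P *m rG t ->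
  forall g, g \in G -> g \notin H -> char_poly (- rG g) = char_poly (rG g).
Proof.
move=> mn freeP PH Pt g gG gH; have [h hH gE] := index2_decomp gG.
case: gE => gE; first by rewrite gE hH in gH.
pose b := a (h ^ t^-1)%g *m c.
pose M := block_mx 0 (a h) b 0.
have MP : M *m P = P *m rG g.
  rewrite gE repr_mxM ?(fintype.subsetP sHG _ hH) // mulmxA -PH // -mulmxA -Pt mulmxA.
  by rewrite mulmx_block !mul0mx !mulmx0 !addr0 !add0r mulmx1.
rewrite -(char_poly_sim mn freeP MP).
rewrite -(@char_poly_sim _ _ _ (- M) (- rG g) _ mn freeP); last first.
  by rewrite mulNmx mulmxN MP.
apply: (@char_poly_sim _ _ _ _ _ (block_mx 1%:M 0 0 (- 1%:M))) => //.
  by rewrite row_free_unit unitmxE det_ublock det1 mul1r -scaleN1r detZ det1 mulr1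
    unitrX ?unitrN1.
rewrite opp_block_mx !mulmx_block !oppr0 !mulmx0 !mul0mx !addr0 !add0r !mulmxN !mulmx1
  !mulNmx !mul1mx.
by rewrite opprK.
Qed.

Lemma restrict_index2 : group_splitting_field F G -> group_splitting_field F H ->
  (mx_irreducible rH /\ exists g, [/\ g \in G, g \notin H & \tr (rG g) != 0]) \/
  exists m (a : mx_representation F H m),
  [/\ mx_irreducible a,
      {in H, forall h, char_poly (rG h) = char_poly (a h) * char_poly (a (h ^ t^-1)%g)},
      forall g, g \in G -> g \notin H -> char_poly (- rG g) = char_poly (rG g)
    & exists2 h, h \in H & \tr (a h) != \tr (a (h ^ t^-1)%g)].
Proof.
move=> splitG splitH; have [irrH|] := Clifford_index2.
  by left; split=> //; apply: irr_restr_trace_neq0; apply: splitH.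
case=> m [a [P [c [irra mn freeP PH Pt]]]]; right; exists m, a; split=> //.
- by move=> h hH; rewrite -(char_poly_sim mn freeP (PH h hH)) char_poly_lblock.
- exact: index2_antidiag mn freeP PH Pt.
- exact: index2_conj_trace (splitG _ _ irrG) (splitH _ _ irra) mn freeP PH Pt.
Qed.

End IndexTwo.

(** * Valuations and roots of unity in a modular system *)

Section Valuation.

Variables (p : nat) (M : pmodular_system p).
Hypothesis p_prime : prime p.
Local Notation K := (pmK M).
Local Notation A := (pmA M).
Local Notation L := (pmL M).
Local Notation emb := (pm_emb M).
Local Notation res := (pm_res M).

Lemma emb_eq0 a : (emb a == 0) = (a == 0).
Proof. by rewrite -(inj_eq (@pm_emb_inj p M)) rmorph0. Qed.

Lemma res_unit a : (res a != 0) = (a \is a GRing.unit).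
Proof. by rewrite pm_res_ker negbK. Qed.

Lemma pchar_L : p \in [pchar L].
Proof.
by rewrite !inE p_prime /= -(rmorph_nat res) pm_res_ker pm_p_max.
Qed.

Lemma natr_L n : (n%:R == 0 :> L) = (p %| n)%N.
Proof. by rewrite (dvdn_pcharf pchar_L). Qed.

Lemma valuation_total (x y : K) :
  (exists a, x = emb a * y) \/ (exists a, y = emb a * x).
Proof.
have [a [b [nzb ->]]] := pm_fraction x; have [c [d [nzd ->]]] := pm_fraction y.
have [nb nd] : emb b != 0 /\ emb d != 0 by rewrite !emb_eq0.
have cross e u v u' v' : emb v != 0 -> emb v' != 0 -> u * v' = e * (u' * v) ->
    emb u / emb v = emb e * (emb u' / emb v').
  move=> nv nv' /(congr1 emb); rewrite !rmorphM => h.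
  by apply/eqP; rewrite mulrA eqr_div // h mulrA.
have [[e he]|[e he]] := pm_valuation (a * d) (c * b); [right|left]; exists e;
  exact: cross.
Qed.

(** Divisibility is total in a valuation ring, so a finite family can be made
    integral by dividing it by one of its members. *)
Lemma valuation_min (I : eqType) (s : seq I) (f : I -> K) :
    (exists2 i, i \in s & f i != 0) ->
  exists2 j, j \in s & f j != 0 /\ forall i, i \in s -> exists a, f i = emb a * f j.
Proof.
elim: s => [[//]|k s IH nz].
have [fs|fs0] := pselect (exists2 i, i \in s & f i != 0); last first.
  have f0 i : i \in s -> f i = 0.
    by move=> si; apply/eqP; apply: contrapT => /negP h; apply: fs0; exists i.
  have nzk : f k != 0.
    case: nz => i; rewrite inE => /orP[/eqP-> //|/f0->].
    by rewrite eqxx.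
  exists k; rewrite ?mem_head //; split=> // i; rewrite inE => /orP[/eqP->|/f0->].
    by exists 1; rewrite rmorph1 mul1r.
  by exists 0; rewrite rmorph0 mul0r.
have [j sj [nzj hj]] := IH fs.
have [kj|[a ja]] := valuation_total (f k) (f j).
  exists j; rewrite ?inE ?sj ?orbT //; split=> // i.
  by rewrite inE => /orP[/eqP->|/hj].
exists k; rewrite ?mem_head //; split; first by apply: contraNneq nzj => k0;
  rewrite ja k0 mulr0.
move=> i; rewrite inE => /orP[/eqP->|/hj[b ->]]; first by exists 1;
  rewrite rmorph1 mul1r.
by exists (b * a); rewrite ja mulrA rmorphM.
Qed.

(** A valuation ring contains the roots of unity of its field of fractions: if
    [x] is not in the ring then its inverse, a power of [x], is. *)
Lemma root_integral n (x : K) : (0 < n)%N -> x ^+ n = 1 ->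
  exists2 a, x = emb a & a ^+ n = 1.
Proof.
move=> n0 xn; suff [a xa] : exists a, x = emb a.
  by exists a => //; apply: (@pm_emb_inj p M); rewrite rmorphXn rmorph1 -xa.
have [[a ->]|[a h]] := valuation_total x 1; first by exists a; rewrite mulr1.
exists (a ^+ n.-1); case: n n0 xn => // n _ xn /=.
rewrite rmorphXn -[x]mul1r -{1}(expr1n _ n) {1}h exprMn -mulrA -exprSr xn mulr1 //.
Qed.

(** For [c = a / b] one has [(c - 1) (1 + c + ... + c^(n-1)) = 0], and the second
    factor reduces to [n], which is not zero. *)
Lemma root_res_inj n a b :
  ~~ (p %| n)%N -> a ^+ n = 1 -> b ^+ n = 1 -> res a = res b -> a = b.
Proof.
move=> pn an bn eab; have n0 : (0 < n)%N by case: n pn {an bn}; rewrite ?dvdn0.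
have rb : res b ^+ n = 1 by rewrite -rmorphXn bn rmorph1.
have bK : b * b ^+ n.-1 = 1 by rewrite -exprS prednK.
pose c := a * b ^+ n.-1.
have rc : res c = 1 by rewrite rmorphM rmorphXn eab -exprS prednK.
have cn : c ^+ n = 1 by rewrite exprMn an mul1r exprAC bn expr1n.
have : (c - 1) * \sum_(i < n) c ^+ i = 0 by rewrite -subrX1 cn subrr.
have u : \sum_(i < n) c ^+ i \is a GRing.unit.
  rewrite -res_unit rmorph_sum (eq_bigr (fun=> 1)) => [|i _];
    last by rewrite rmorphXn rc expr1n.
  by rewrite sumr_const card_ord natr_L.
move/(canRL (mulrK u)); rewrite mul0r => /eqP; rewrite subr_eq0 => /eqP c1.
by rewrite -[a]mulr1 -bK mulrCA mulrC -/c c1 mul1r.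
Qed.

Lemma pnat_root1 n (y : L) : (p.-nat n)%N -> y ^+ n = 1 -> y = 1.
Proof.
move=> /(p_natP)[k ->]; elim: k => [|k IH]; first by rewrite expr1.
rewrite expnSr exprM => h; apply: IH; apply: (fmorph_inj (pFrobenius_aut pchar_L)).
by rewrite rmorph1 /= pFrobenius_autE h.
Qed.

Section Group.

Variables (gT : finGroupType) (X : {group gT}).
Hypothesis largeX : large_enough M X.

Lemma large_sub (Y : {group gT}) : Y \subset X -> large_enough M Y.
Proof. by move=> sYX Z sZY; apply: largeX; apply: fintype.subset_trans sZY sYX. Qed.

Lemma large_cycle g : g \in X ->
  group_splitting_field K <[g]> /\ group_splitting_field L <[g]>.
Proof. by move=> gX; apply: largeX; rewrite cycle_subG. Qed.

Lemma pelt_order (g : gT) : (p^'.-elt g)%g -> ~~ (p %| #[g]%g)%N.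
Proof. by rewrite /p_elt p'natE. Qed.

(** The splitting hypothesis for the cyclic group generated by [g] provides a
    primitive root of unity over [K]; its reduction is still primitive, so that
    its powers reach every root of unity over [L] of that order. *)
Lemma root_lift (g : gT) (y : L) : g \in X -> (p^'.-elt g)%g -> y ^+ #[g]%g = 1 ->
  exists2 a : A, a ^+ #[g]%g = 1 & res a = y.
Proof.
move=> gX pg yn; have pn := pelt_order pg; have n0 := order_gt0 g.
have [splitK _] := large_cycle gX.
have [z zprim] : exists z : K, #[g]%g.-primitive_root z.
  apply: contrapT => nz; suff: false by [].
  apply: (splitting_cyclic_primitive_root_pchar (cycle_cyclic g) _ splitK).
    by apply/pgroupP => q _ _; rewrite inE /= pm_char0.
  by case=> z zprim; case: nz; exists z.
have [w zw wn] := root_integral n0 (prim_expr_order zprim).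
have rwn : res w ^+ #[g]%g = 1 by rewrite -rmorphXn wn rmorph1.
have [m mprim mdiv] := prim_order_exists n0 rwn.
have mn : m = #[g]%g.
  apply/eqP; rewrite eqn_dvd mdiv (prim_order_dvd zprim) zw -rmorphXn.
  suff -> : w ^+ m = 1 by rewrite rmorph1 eqxx.
  apply: (root_res_inj pn) => [||]; rewrite ?expr1n //;
    first by rewrite exprAC wn expr1n.
  by rewrite rmorphXn rmorph1 prim_expr_order.
rewrite mn in mprim; have [i ->] := prim_rootP mprim yn.
by exists (w ^+ i); rewrite ?rmorphXn // exprAC wn expr1n.
Qed.

Lemma roots_lift (g : gT) (s : seq L) : g \in X -> (p^'.-elt g)%g ->
    (forall y, y \in s -> y ^+ #[g]%g = 1) ->
  exists s' : seq A, (forall a, a \in s' -> a ^+ #[g]%g = 1) /\ map res s' = s.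
Proof.
move=> gX pg; elim: s => [_|y s IH h]; first by exists [::].
have [a an ay] := root_lift gX pg (h y (mem_head _ _)).
have [s' [hs' es']] := IH (fun z zs => h z (@mem_behead _ (y :: s) z zs)).
exists (a :: s'); split=> [b|]; last by rewrite /= ay es'.
by rewrite inE => /orP[/eqP->|/hs'].
Qed.

Lemma char_poly_roots (F : fieldType) n (rX : mx_representation F X n) g :
    group_splitting_field F <[g]> -> g \in X ->
  exists s : seq F, (forall y, y \in s -> y ^+ #[g]%g = 1) /\
    char_poly (rX g) = \prod_(y <- s) ('X - y%:P).
Proof.
move=> splitC gX; have sCX : <[g]>%g \subset X by rewrite cycle_subG.
have [s [hs e]] := char_poly_abelian (subg_repr rX sCX) splitC (cycle_abelian g).
exists [seq (l : {ffun gT -> F}) g | l <- s]; split;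
  last by rewrite big_map -e // cycle_id.
move=> _ /mapP[l /hs[l1 lM] ->].
have lX k : l (g ^+ k)%g = l g ^+ k.
  elim: k => [|k IH]; first by rewrite expg0 l1 expr0.
  by rewrite expgS exprS lM ?IH ?mem_cycle ?cycle_id.
by rewrite -lX expg_order.
Qed.

(** Linear characters with values in [L] are trivial on [p]-elements. *)
Lemma char_poly_p' n (rX : mx_representation L X n) g :
  g \in X -> char_poly (rX g) = char_poly (rX (g.`_p^')%g).
Proof.
move=> gX; have [_ splitC] := large_cycle gX.
have sCX : <[g]>%g \subset X by rewrite cycle_subG.
have [s [hs e]] := char_poly_abelian (subg_repr rX sCX) splitC (cycle_abelian g).
rewrite (e g (cycle_id g)) (e _ (cycle_constt p^' g));
  apply: eq_big_seq => l /hs[l1 lM].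
rewrite -{1}(consttC p g) lM ?cycle_constt //.
suff -> : l (g.`_p)%g = 1 by rewrite mul1r.
apply: (@pnat_root1 #[(g.`_p)%g]%g); first exact: p_elt_constt.
have lX k : l ((g.`_p) ^+ k)%g = l (g.`_p)%g ^+ k.
  elim: k => [|k IH]; first by rewrite expg0 l1 expr0.
  by rewrite expgS exprS lM ?IH //; [|apply: groupX]; apply: cycle_constt.
by rewrite -lX expg_order.
Qed.

End Group.
End Valuation.

(** * Multiplicities in a free family of functions *)

Section Free.

Variables (p : nat) (M : pmodular_system p) (gT : finGroupType).
Local Notation K := (pmK M).
Local Notation cfun := (cfunK M gT).
Implicit Types (S : set cfun) (f s : cfun) (l : seq cfun).

Definition free_family S :=
  forall l, uniq l -> (forall s, s \in l -> S s) ->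
  forall c : cfun -> K, (forall g, \sum_(s <- l) c s * s g = 0) ->
  forall s, s \in l -> c s = 0.

Lemma pm_K_natr n : (n%:R == 0 :> K) = (n == 0%N).
Proof. by apply: (pcharf0P K).1; apply: pm_char0. Qed.

Lemma natK_inj m n : m%:R = n%:R :> K -> m = n.
Proof.
wlog le_mn : m n / (m <= n)%N => [wl h|].
  by case/orP: (leq_total m n) => le; [apply: wl|apply/esym/wl].
move=> /eqP; rewrite eq_sym -subr_eq0 -natrB // pm_K_natr subn_eq0 => le_nm.
by apply/eqP; rewrite eqn_leq le_mn.
Qed.

(** A larger independent set of functions on [gT] would give a matrix with more
    rows than columns and trivial kernel. *)
Lemma free_size S l : free_family S -> uniq l -> (forall s, s \in l -> S s) ->
  (size l <= #|gT|)%N.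
Proof.
move=> freeS ul lS; rewrite leqNgt; apply/negP => lt.
pose m : 'M[K]_(size l, #|gT|) := \matrix_(i, j) (nth 0 l i) (enum_val j).
have /rowV0Pn[v /sub_kermxP vm nzv] : kermx m != 0.
  rewrite -mxrank_eq0 mxrank_ker subn_eq0 -ltnNge.
  by apply: leq_ltn_trans lt; apply: rank_leq_col.
case/eqP: nzv; apply/rowP => i; rewrite mxE.
pose c s : K := if insub (index s l) is Some j then v 0 j else 0.
have cE (j : 'I_(size l)) : c (nth 0 l j) = v 0 j.
  by rewrite /c index_uniq // valK.
rewrite -cE; apply: (freeS l ul lS) => [g|]; last exact: mem_nth.
rewrite (big_nth 0) big_mkord; have /rowP/(_ (enum_rank g)) := vm.
rewrite !mxE => h; rewrite -[RHS]h; apply: eq_bigr => j _.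
by rewrite cE !mxE enum_rankK.
Qed.

Lemma free_finite S : free_family S ->
  exists2 r : seq cfun, uniq r & forall s, S s <-> s \in r.
Proof.
move=> freeS.
pose P n := `[< exists l, [/\ uniq l, forall s, s \in l -> S s & size l = n] >].
have exP : exists n, P n by exists 0%N; apply/asboolP; exists [::]; split.
have ubP n : P n -> (n <= #|gT|)%N by move=> /asboolP[l [ul lS <-]];
  apply: free_size lS.
case: (ex_maxnP exP ubP) => _ /asboolP[r [ur rS <-]] nmax.
exists r => // s; split=> [Ss|/rS //]; apply: contrapT => /negP nsr.
have /nmax : P (size (s :: r)); last by rewrite /= ltnn.
apply/asboolP; exists (s :: r); split=> //=; first by rewrite nsr.
by move=> s'; rewrite inE => /orP[/eqP->|/rS].
Qed.

Lemma sum_count (r l : seq cfun) g : uniq r -> {subset l <= r} ->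
  (\sum_(s <- l) s) g = \sum_(s <- r) (count_mem s l)%:R * s g.
Proof.
move=> ur; elim: l => [|t l IH] lr.
  by rewrite big_nil ffunE big1 // => s _; rewrite /= mul0r.
rewrite big_cons ffunE IH => [|s sl]; last by apply: lr; rewrite inE sl orbT.
have tr : t \in r by apply: lr; rewrite mem_head.
rewrite [RHS](eq_bigr (fun s => (t == s)%:R * s g + (count_mem s l)%:R * s g)) =>
  [|s _]; last first.
  by rewrite /= natrD mulrDl.
rewrite big_split /=; congr (_ + _).
rewrite (bigD1_seq t) //= eqxx mul1r big1 ?addr0 // => s.
by rewrite eq_sym => /negbTE->; rewrite mul0r.
Qed.

Lemma coefficient_count S l f s : free_family S -> (forall t, t \in l -> S t) ->
  f = \sum_(t <- l) t -> S s -> coefficient S f s = (count_mem s l)%:R.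
Proof.
move=> freeS lS fE Ss; have [r ur rS] := free_finite freeS.
have SE : S = [set` r] by apply/seteqP; split=> t /= /rS.
have lr : {subset l <= r} by move=> t /lS/rS.
have sumE (F : cfun -> K) : \sum_(t \in S) F t = \sum_(t <- r) F t.
  by rewrite SE -fsbig_seq.
rewrite /coefficient; apply: xget_unique.
  exists (fun t => (count_mem t l)%:R); split=> // g.
  by rewrite sumE fE (sum_count _ ur lr).
move=> _ [c [fc ->]]; apply/eqP; rewrite -subr_eq0; apply/eqP.
apply: (freeS r ur _ (fun t => c t - (count_mem t l)%:R)); last exact/rS.
  by move=> t /rS.
move=> g; rewrite (eq_bigr (fun t => c t * t g - (count_mem t l)%:R * t g)) => [|t _].
  by rewrite sumrB -sumE -fc fE (sum_count _ ur lr) subrr.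
by rewrite mulrBl.
Qed.

Definition decomposes S f l := (forall s, s \in l -> S s) /\ f = \sum_(s <- l) s.

Definition effective S f := exists l, decomposes S f l.

(** When [S] is free the list of constituents is unique up to permutation, so
    every choice of [xget] gives the same multiplicities. *)
Definition mult S f s : nat := count_mem s (xget [::] [set l | decomposes S f l]).

Section Mult.

Variable S : set cfun.
Hypothesis freeS : free_family S.

Lemma mult_count f l s : decomposes S f l -> mult S f s = count_mem s l.
Proof.
move=> [lS fE]; rewrite /mult; case: xgetP => [l' _ /= [lS' fE']|no]; last first.
  by have := no l; case; split.
have [Ss|nSs] := pselect (S s).
  apply: natK_inj; rewrite -(coefficient_count freeS lS' fE' Ss).
  exact: coefficient_count.
have nl l0 : (forall s, s \in l0 -> S s) -> count_mem s l0 = 0%N.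
  by move=> l0S; apply/eqP; rewrite -leqn0 leqNgt -has_count has_pred1;
    apply/negP => /l0S.
by rewrite !nl.
Qed.

Lemma coefficient_mult f s : effective S f -> S s ->
  coefficient S f s = (mult S f s)%:R.
Proof. by move=> [l h] Ss; rewrite (mult_count s h); case: h => lS fE;
  apply: coefficient_count. Qed.

Lemma mult_notin f s : effective S f -> ~ S s -> mult S f s = 0%N.
Proof.
move=> [l h] nSs; rewrite (mult_count s h); apply/eqP;
  rewrite -leqn0 leqNgt -has_count has_pred1.
by apply/negP => /h.1.
Qed.

Lemma mult_gt0 f l s : decomposes S f l -> (0 < mult S f s)%N = (s \in l).
Proof. by move=> h; rewrite (mult_count s h) -has_count has_pred1. Qed.

Lemma decomposes1 s : S s -> decomposes S s [:: s].
Proof. by move=> Ss; split=> [t|]; rewrite ?big_seq1 // inE => /eqP->. Qed.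

Lemma decomposes_cat f1 f2 l1 l2 :
  decomposes S f1 l1 -> decomposes S f2 l2 -> decomposes S (f1 + f2) (l1 ++ l2).
Proof.
move=> [h1 e1] [h2 e2]; split=> [s|]; last by rewrite big_cat /= -e1 -e2.
by rewrite mem_cat => /orP[/h1|/h2].
Qed.

Lemma effective1 s : S s -> effective S s.
Proof. by move=> Ss; exists [:: s]; apply: decomposes1. Qed.

Lemma effectiveD f1 f2 : effective S f1 -> effective S f2 -> effective S (f1 + f2).
Proof. by move=> [l1 h1] [l2 h2]; exists (l1 ++ l2); apply: decomposes_cat. Qed.

Lemma mult1 s s' : S s -> mult S s s' = (s == s').
Proof. by move=> Ss; rewrite (mult_count _ (decomposes1 Ss)) /= addn0. Qed.

Lemma multD f1 f2 s : effective S f1 -> effective S f2 ->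
  mult S (f1 + f2) s = (mult S f1 s + mult S f2 s)%N.
Proof.
move=> [l1 h1] [l2 h2]; rewrite (mult_count s h1) (mult_count s h2).
by rewrite (mult_count s (decomposes_cat h1 h2)) count_cat.
Qed.

Lemma effective_sum (I : eqType) (r : seq I) (f : I -> cfun) :
  (forall i, i \in r -> effective S (f i)) -> effective S (\sum_(i <- r) f i).
Proof.
elim: r => [|i r IH] h; first by rewrite big_nil; exists [::]; split; rewrite ?big_nil.
rewrite big_cons; apply: effectiveD; first by apply: h; rewrite mem_head.
by apply: IH => j jr; apply: h; rewrite inE jr orbT.
Qed.

Lemma mult_sum (I : eqType) (r : seq I) (f : I -> cfun) s :
    (forall i, i \in r -> effective S (f i)) ->
  mult S (\sum_(i <- r) f i) s = (\sum_(i <- r) mult S (f i) s)%N.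
Proof.
elim: r => [|i r IH] h.
  rewrite !big_nil (@mult_count _ [::]) //; split; rewrite ?big_nil //.
rewrite !big_cons multD ?IH //.
- by move=> j jr; apply: h; rewrite inE jr orbT.
- by apply: h; rewrite mem_head.
- by apply: effective_sum => j jr; apply: h; rewrite inE jr orbT.
Qed.

End Mult.
End Free.

(** * Brauer characters *)

Section Brauer.

Variables (p : nat) (M : pmodular_system p) (gT : finGroupType).
Hypothesis p_prime : prime p.
Local Notation K := (pmK M).
Local Notation A := (pmA M).
Local Notation L := (pmL M).
Local Notation emb := (pm_emb M).
Local Notation res := (pm_res M).

(** The value of a Brauer character at [g] depends only on the characteristic
    polynomial [q], which makes Brauer characters additive along submodules. *)
Definition Brauer_value (g : gT) (q : {poly L}) (v : K) :=
  exists s : seq A, [/\ forall a, a \in s -> a ^+ #[g]%g = 1,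
    q = \prod_(a <- s) ('X - (res a)%:P) & v = emb (\sum_(a <- s) a)].

Lemma Brauer_value_uniq g q v v' : (p^'.-elt g)%g ->
  Brauer_value g q v -> Brauer_value g q v' -> v = v'.
Proof.
move=> pg [s [hs -> ->]] [s' [hs' e ->]].
have pn := pelt_order p_prime pg.
pose lift y := xget 0 [set a : A | a ^+ #[g]%g = 1 /\ res a = y].
have liftK (r : seq A) : (forall a, a \in r -> a ^+ #[g]%g = 1) ->
  map lift (map res r) = r.
  move=> hr; rewrite -map_comp -[RHS]map_id; apply/seq.eq_in_map => a /hr an /=.
  apply: xget_unique; first by split.
  by move=> b [bn ba]; apply: (root_res_inj p_prime pn) bn an ba.
have : perm_eq (map res s) (map res s').
  by apply: prod_XsubC_eq; rewrite !big_map.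
move=> /(perm_map lift); rewrite !liftK // => ss'.
by rewrite (perm_big _ ss').
Qed.

Lemma Brauer_value_mul g q1 q2 v1 v2 :
  Brauer_value g q1 v1 -> Brauer_value g q2 v2 -> Brauer_value g (q1 * q2) (v1 + v2).
Proof.
move=> [s1 [h1 -> ->]] [s2 [h2 -> ->]]; exists (s1 ++ s2); split=> [a||].
- by rewrite mem_cat => /orP[/h1|/h2].
- by rewrite big_cat.
- by rewrite big_cat rmorphD.
Qed.

Lemma Brauer_value_trace g n (B : 'M[L]_n) v :
  Brauer_value g (char_poly B) v -> exists2 a, v = emb a & \tr B = res a.
Proof.
move=> [s [_ e ->]]; exists (\sum_(a <- s) a) => //; rewrite rmorph_sum.
have ss : size s = n.
  have := size_char_poly B; rewrite e -(big_map res xpredT (fun y => 'X - y%:P)).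
  by rewrite size_prod_XsubC size_map => -[].
case: n => [|n] in B e ss *.
  by case: s ss {e} => // _; rewrite big_nil /mxtrace big_ord0.
apply: oppr_inj; rewrite -char_poly_trace // e -(big_map res xpredT (fun y =>
  'X - y%:P)).
have -> : n.+1.-1 = (size (map res s)).-1 by rewrite size_map ss.
by rewrite coefPn_prod_XsubC ?size_map ?ss // big_map.
Qed.

Section Group.

Variable (X : {group gT}).
Hypothesis largeX : large_enough M X.

Lemma affords_Brauer_uniq n1 n2 (r1 : mx_representation L X n1)
    (r2 : mx_representation L X n2) phi1 phi2 :
    affords_Brauer r1 phi1 -> affords_Brauer r2 phi2 ->
    (forall g, g \in X -> (p^'.-elt g)%g -> char_poly (r1 g) = char_poly (r2 g)) ->
  phi1 = phi2.
Proof.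
move=> [z1 v1] [z2 v2] e; apply/ffunP => g.
have [/andP[gX pg]|ng] := boolP ((g \in X) && (p^'.-elt g)%g); last by rewrite z1 // z2.
have h2 : Brauer_value g (char_poly (r1 g)) (phi2 g) by rewrite e //; apply: v2.
exact: (Brauer_value_uniq pg (v1 g gX pg) h2).
Qed.

Lemma affords_Brauer_exists n (rX : mx_representation L X n) : exists phi,
  affords_Brauer rX phi.
Proof.
pose P g v := if (g \in X) && (p^'.-elt g)%g
  then Brauer_value g (char_poly (rX g)) v else v = 0.
have ex g : exists v : K, P g v.
  rewrite /P; have [/andP[gX pg]|_] := boolP ((g \in X) && _); last by exists 0.
  have [_ splitC] := large_cycle largeX gX.
  have [s [hs ->]] := char_poly_roots rX splitC gX.
  have [s' [hs' <-]] := roots_lift p_prime largeX gX pg hs.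
  by exists (emb (\sum_(a <- s') a)), s'; split=> //; rewrite big_map.
have [f hf] := choice ex; exists (finfun f); split=> [g ng|g gX pg]; rewrite ffunE.
  by have := hf g; rewrite /P (negbTE ng).
by have := hf g; rewrite /P gX pg.
Qed.

Lemma affords_BrauerD n n1 n2 (rX : mx_representation L X n) (r1 : mx_representation L
  X n1)
    (r2 : mx_representation L X n2) phi1 phi2 :
    affords_Brauer r1 phi1 -> affords_Brauer r2 phi2 ->
    (forall g, g \in X -> (p^'.-elt g)%g ->
       char_poly (rX g) = char_poly (r1 g) * char_poly (r2 g)) ->
  affords_Brauer rX (phi1 + phi2).
Proof.
move=> [z1 v1] [z2 v2] e; split=> [g ng|g gX pg]; rewrite ffunE.
  by rewrite z1 // z2 // addr0.
rewrite e //; apply: Brauer_value_mul; [exact: v1|exact: v2].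
Qed.

Lemma trace_p' n (rX : mx_representation L X n) g :
  g \in X -> \tr (rX g) = \tr (rX (g.`_p^')%g).
Proof. by move=> gX; apply: eq_char_poly_trace; apply: char_poly_p'. Qed.

Lemma Irr_supp chi g : Irr M X chi -> g \notin X -> chi g = 0.
Proof. by move=> [n [rX [_ ->]]] gX; rewrite ffunE (negbTE gX). Qed.

Lemma IBr_supp chi g : IBr M X chi -> ~~ ((g \in X) && (p^'.-elt g)%g) -> chi g = 0.
Proof. by move=> [n [rX [_ [z _]]]] gX; rewrite z. Qed.

(** Ordinary characters are traces of inequivalent representations. *)
Lemma Irr_free : free_family (Irr M X).
Proof.
move=> l ul lS c rel s0 s0l; pose li := tnth (in_tuple l).
have exr : forall i, exists R : {n & mx_representation K X n},
    mx_irreducible (projT2 R) /\ affords (projT2 R) (li i).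
  by move=> i; have [n [rX h]] := lS (li i) (mem_tnth _ _); exists (existT _ n rX).
have [r hr] := choice exr.
have abs i : mx_absolutely_irreducible (projT2 (r i)).
  by apply: (largeX (fintype.subxx X)).1; have [] := hr i.
have nsim i j : i != j -> ~ mx_rsim (projT2 (r i)) (projT2 (r j)).
  move=> ij sim; case/eqP: ij; apply/(tuple_uniqP (in_tuple l)) => //.
  rewrite -/(li i) -/(li j); have [_ ->] := hr i; have [_ ->] := hr j.
  by apply/ffunP => g; rewrite !ffunE; case: ifP => // gX; apply: mxtrace_rsim sim _ gX.
have rel' : {in X, forall g, \sum_i c (li i) * \tr (projT2 (r i) g) = 0}.
  move=> g gX; rewrite -[RHS](rel g) [RHS]big_tnth; apply: eq_bigr => i _.
  by rewrite -/(li i); have [_ {3}->] := hr i; rewrite ffunE gX.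
have /tnthP[i ->] : s0 \in in_tuple l by [].
exact: (irr_trace_free abs nsim rel' i).
Qed.

(** A nontrivial linear relation between Brauer characters can be scaled to have
    coefficients in [A], one of them a unit. Its reduction is a relation between
    the traces of inequivalent representations over [L], first on the
    [p]-regular elements and then everywhere, since [g] and its [p']-part have
    the same eigenvalues. *)
Lemma IBr_free : free_family (IBr M X).
Proof.
move=> l ul lS c rel; pose li := tnth (in_tuple l).
apply: contrapT => nz.
have /valuation_min[j jl [nzj hj]] : exists2 s, s \in l & c s != 0.
  apply: contrapT => all0; apply: nz => s sl; apply/eqP; apply: contrapT => /negP h.
  by apply: all0; exists s.
have exb : forall i, exists a, c (li i) = emb a * c j.
  by move=> i; apply: hj; apply: mem_tnth.
have [b hb] := choice exb.
have exr : forall i, exists R : {n & mx_representation L X n},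
    mx_irreducible (projT2 R) /\ affords_Brauer (projT2 R) (li i).
  by move=> i; have [n [rX h]] := lS (li i) (mem_tnth _ _); exists (existT _ n rX).
have [r hr] := choice exr.
have abs i : mx_absolutely_irreducible (projT2 (r i)).
  by apply: (largeX (fintype.subxx X)).2; have [] := hr i.
have nsim i j' : i != j' -> ~ mx_rsim (projT2 (r i)) (projT2 (r j')).
  move=> ij sim; case/eqP: ij; apply/(tuple_uniqP (in_tuple l)) => //.
  rewrite -/(li i) -/(li j'); have [_ hi] := hr i; have [_ hj'] := hr j'.
  by apply: affords_Brauer_uniq hi hj' _ => g gX _; apply: char_poly_rsim.
have relp g : g \in X -> (p^'.-elt g)%g -> \sum_i res (b i) * \tr (projT2 (r i) g) = 0.
  move=> gX pg; have exv : forall i, exists a, li i g = emb a /\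
    \tr (projT2 (r i) g) = res a.
    move=> i; have [_ [_ /(_ g gX pg) h]] := hr i.
    by have [a h1 h2] := Brauer_value_trace h; exists a.
  have [v hv] := choice exv.
  rewrite (eq_bigr (fun i => res (b i * v i))) => [|i _]; last first.
    by rewrite rmorphM (hv i).2.
  rewrite -rmorph_sum; suff -> : \sum_i b i * v i = 0 by rewrite rmorph0.
  apply: (@pm_emb_inj p M); rewrite rmorph0 rmorph_sum; apply: (mulIf nzj).
  rewrite mul0r -[RHS](rel g) [RHS]big_tnth mulr_suml; apply: eq_bigr => i _.
  by rewrite -/(li i) hb (hv i).1 rmorphM mulrAC.
have rel' : {in X, forall g, \sum_i res (b i) * \tr (projT2 (r i) g) = 0}.
  move=> g gX; rewrite -[RHS](relp (g.`_p^')%g); last exact: p_elt_constt.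
    by apply: eq_bigr => i _; rewrite trace_p'.
  by rewrite groupX.
have /tnthP[i ij] : j \in in_tuple l by [].
have /eqP := irr_trace_free abs nsim rel' i; have := hb i; rewrite /li -ij.
move=> /esym/(canRL (mulfK nzj)); rewrite divff // => b1.
have -> : b i = 1 by apply: (@pm_emb_inj p M); rewrite rmorph1.
by rewrite rmorph1 oner_eq0.
Qed.

End Group.
End Brauer.

(** * Reduction modulo the maximal ideal, decomposition and blocks *)

(** Cramer's rule: replacing row [k] of [P] by [v]. *)
Lemma mul_invmx_replace_row (F : fieldType) n (P Q : 'M[F]_n) (v : 'rV_n) k :
    P \in unitmx -> row k Q = v -> (forall i, i != k -> row i Q = row i P) ->
  (v *m invmx P) 0 k = \det Q / \det P.
Proof.
move=> uP vQ rowQ; rewrite /invmx uP -scalemxAr mxE mulrC; congr (_ / _).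
rewrite (expand_det_row Q k) mxE; apply: eq_bigr => j _.
rewrite -vQ !mxE; congr (_ * _); rewrite /cofactor; congr (_ * \det _).
apply/matrixP => i l; rewrite !mxE.
have ki : lift k i != k by rewrite eq_sym neq_lift.
by have /rowP/(_ (lift j l)) := rowQ _ ki; rewrite !mxE.
Qed.

Section Reduction.

Variables (p : nat) (M : pmodular_system p) (gT : finGroupType).
Hypothesis p_prime : prime p.
Local Notation K := (pmK M).
Local Notation A := (pmA M).
Local Notation L := (pmL M).
Local Notation emb := (pm_emb M).
Local Notation res := (pm_res M).

Variable (X : {group gT}).

Lemma emb_mx_inj n : injective (map_mx emb : 'M_n -> 'M_n).
Proof.
by move=> B C /matrixP e; apply/matrixP => i j; apply: pm_emb_inj; have := e i j;
  rewrite !mxE.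
Qed.

(** The translates of the standard basis vectors span a lattice stable under
    [X]. Choose among them [n] vectors whose determinant has minimal valuation:
    by Cramer's rule all the others are integral combinations of these, so they
    form a basis of the lattice, in which [X] acts by matrices over [A]. *)
Lemma integral_form n (rX : mx_representation K X n) :
  exists rA : mx_representation A X n, mx_rsim (map_repr emb rA) rX.
Proof.
pose P (f : {ffun 'I_n -> gT * 'I_n}) := \matrix_i row (f i).2 (rX (f i).1).
pose inX (f : {ffun 'I_n -> gT * 'I_n}) := [forall i, (f i).1 \in X].
have nz : exists2 f, f \in enum inX & \det (P f) != 0.
  exists [ffun i => (1%g, i)].
    by rewrite mem_enum; apply/forallP => i; rewrite ffunE group1.
  have -> : P [ffun i => (1%g, i)] = 1%:M.
    by apply/row_matrixP => i; rewrite rowK ffunE /= repr_mx1.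
  by rewrite det1 oner_eq0.
have [f fX [nzf minf]] := valuation_min nz.
have uP : P f \in unitmx by rewrite unitmxE unitfE.
have {}fX i : (f i).1 \in X by move: fX; rewrite mem_enum => /forallP.
pose B h := P f *m rX h *m invmx (P f).
have exa (x : gT * ('I_n * 'I_n)) : exists a, x.1 \in X -> B x.1 x.2.1 x.2.2 = emb a.
  case: x => h [i k] /=; have [hX|] := boolP (h \in X); last by exists 0.
  pose f' := [ffun j => if j == k then (((f i).1 * h)%g, (f i).2) else f j].
  have [|a ha] := minf f'.
    rewrite mem_enum; apply/forallP => j; rewrite ffunE.
    by case: ifP => _ //=; rewrite groupM.
  exists a => _; have -> : B h i k = (row i (P f *m rX h) *m invmx (P f)) 0 k.
    by rewrite -row_mul [RHS]mxE.
  rewrite (@mul_invmx_replace_row _ _ _ (P f') _ k uP).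
  - by rewrite ha mulfK.
  - by rewrite rowK ffunE eqxx /= row_mul rowK repr_mxM // row_mul.
  - by move=> j /negbTE jk; rewrite !rowK ffunE jk.
have [a ha] := choice exa.
pose rA h := \matrix_(i, j) a (h, (i, j)).
have rAB h : h \in X -> map_mx emb (rA h) = B h.
  by move=> hX; apply/matrixP => i j; rewrite 2!mxE -(ha (h, (i, j))).
have rA_repr : mx_repr X rA.
  split=> [|x y xX yX]; apply: emb_mx_inj.
    by rewrite rAB // /B repr_mx1 mulmx1 mulmxV // map_mx1.
  by rewrite map_mxM !rAB ?groupM // /B repr_mxM // !mulmxA mulmxKV.
exists (MxRepresentation rA_repr); exists (P f) => //; first by rewrite row_free_unit.
by move=> x xX; rewrite /= /map_repr_mx /= rAB // /B mulmxKV.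
Qed.

Hypothesis largeX : large_enough M X.

Lemma map_char_poly_res n (rA : mx_representation A X n) g (s : seq A) :
    g \in X -> char_poly (map_repr emb rA g) = \prod_(a <- s) ('X - (emb a)%:P) ->
  char_poly (map_repr res rA g) = \prod_(a <- s) ('X - (res a)%:P).
Proof.
move=> gX; rewrite -!map_char_poly => e.
have -> : char_poly (rA g) = \prod_(a <- s) ('X - a%:P).
  apply: (map_inj_poly (@pm_emb_inj p M) (rmorph0 emb)).
  rewrite e rmorph_prod; apply: eq_bigr => a _.
  by rewrite /= map_polyXsubC.
by rewrite rmorph_prod; apply: eq_bigr => a _; rewrite /= map_polyXsubC.
Qed.

Lemma reduction_affords n (rA : mx_representation A X n) chi :
    affords (map_repr emb rA) chi ->
  affords_Brauer (map_repr res rA) (pregular_part chi).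
Proof.
move=> ->; split=> [g ng|g gX pg]; rewrite !ffunE.
  by move: ng; rewrite negb_and; case: ifP => // pg; rewrite orbF => /negbTE->.
rewrite gX pg; have [splitC _] := large_cycle largeX gX.
have [s [hs e]] := char_poly_roots (map_repr emb rA) splitC gX.
have [s' [hs' es]] : exists s' : seq A, (forall a, a \in s' ->
  a ^+ #[g]%g = 1) /\ map emb s' = s.
  elim: s hs {e} => [_|y s IH h]; first by exists [::].
  have [a ya an] := root_integral (order_gt0 g) (h y (mem_head _ _)).
  have [|s' [hs' es']] := IH; first by move=> z zs; apply: h; rewrite inE zs orbT.
  exists (a :: s'); split=> [b|]; last by rewrite /= -ya es'.
  by rewrite inE => /orP[/eqP->|/hs'].
exists s'; split=> //; first by apply: map_char_poly_res => //; rewrite e -es big_map.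
have ss : size s = n.
  have := size_char_poly (map_repr emb rA g).
  by rewrite e size_prod_XsubC => -[].
rewrite rmorph_sum -(big_map emb xpredT id) es.
case: n => [|n] in rA e ss *.
  by case: s ss {e es hs} => // _; rewrite big_nil /mxtrace big_ord0.
apply: oppr_inj; rewrite -char_poly_trace // e.
have -> : n.+1.-1 = (size s).-1 by rewrite ss.
by rewrite coefPn_prod_XsubC ?ss.
Qed.

Definition class_sums_act n (rX : mx_representation L X n) (lam : cfunL M gT) :=
  forall x, x \in X -> \sum_(y in (x ^: X)%g) rX y = (lam x)%:M.

Lemma class_sub x y : x \in X -> y \in (x ^: X)%g -> y \in X.
Proof. by move=> xX /imsetP[z zX ->]; rewrite groupJ. Qed.

Lemma class_sums_act_sub n (rX : mx_representation L X n) (U : 'M_n) (Umod : mxmodule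
  rX U) lam :
  class_sums_act rX lam -> class_sums_act (submod_repr Umod) lam.
Proof.
move=> act x xX; have -> : \sum_(y in (x ^: X)%g) submod_repr Umod y =
    in_submod U (val_submod 1%:M *m \sum_(y in (x ^: X)%g) rX y).
  by rewrite mulmx_sumr linear_sum.
by rewrite act // mul_mx_scalar !linearZ /= val_submodK scalemx1.
Qed.

Lemma class_sums_act_fact n (rX : mx_representation L X n) (U : 'M_n) (Umod : mxmodule
  rX U) lam :
  class_sums_act rX lam -> class_sums_act (factmod_repr Umod) lam.
Proof.
move=> act x xX; have -> : \sum_(y in (x ^: X)%g) factmod_repr Umod y =
    in_factmod U (val_factmod 1%:M *m \sum_(y in (x ^: X)%g) rX y).
  by rewrite mulmx_sumr linear_sum.
by rewrite act // mul_mx_scalar !linearZ /= val_factmodK scalemx1.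
Qed.

Lemma affords_Brauer0 (rX : mx_representation L X 0) phi : affords_Brauer rX phi ->
  phi = 0.
Proof.
move=> h; apply: (affords_Brauer_uniq p_prime h (r2 := rX)) => //.
split=> [g _|g _ _]; rewrite ffunE //; exists [::]; split=> //.
  by rewrite big_nil /char_poly det_mx00.
by rewrite big_nil rmorph0.
Qed.

(** The Brauer character splits along the composition factors, and each factor
    inherits the action of the class sums when these act by scalars. *)
Lemma Brauer_decomposition n (rX : mx_representation L X n) phi :
    affords_Brauer rX phi ->
  exists l, decomposes (IBr M X) phi l /\
    forall beta lam, beta \in l -> class_sums_act rX lam -> IBr_block X lam beta.
Proof.
elim/repr_ind: n / rX phi => [rX|n rX irr|n rX U Umod IH1 IH2] phi aff.
- exists [::]; split=> //; split=> //; rewrite big_nil; exact: affords_Brauer0 aff.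
- exists [:: phi]; split; last first.
    by move=> beta lam; rewrite inE => /eqP-> act; exists n, rX.
  by apply: decomposes1; exists n, rX.
have [phi1 aff1] := affords_Brauer_exists p_prime largeX (submod_repr Umod).
have [phi2 aff2] := affords_Brauer_exists p_prime largeX (factmod_repr Umod).
have [l1 [d1 b1]] := IH1 _ aff1; have [l2 [d2 b2]] := IH2 _ aff2.
have aff12 : affords_Brauer rX (phi1 + phi2).
  by apply: affords_BrauerD aff1 aff2 _ => g gX _; apply: char_poly_sub_fact.
have -> : phi = phi1 + phi2 by apply: (affords_Brauer_uniq p_prime aff aff12).
exists (l1 ++ l2); split; first exact: decomposes_cat.
move=> beta lam; rewrite mem_cat => /orP[bl|bl] act.
  by apply: b1 bl _; apply: class_sums_act_sub.
by apply: b2 bl _; apply: class_sums_act_fact.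
Qed.

Lemma IBr_blockW (lam : cfunL M gT) beta : IBr_block X lam beta -> IBr M X beta.
Proof. by move=> [n [rX [irr aff _]]]; exists n, rX. Qed.

(** A class sum acts on an integral form of an absolutely irreducible
    representation by a scalar, which is therefore integral; its reduction acts
    on every composition factor of the reduced representation. *)
Lemma Irr_decomposition chi : Irr M X chi ->
  exists (lam : cfunL M gT) l, [/\ forall x, x \notin X ->
    lam x = 0, Irr_block X lam chi,
    decomposes (IBr M X) (pregular_part chi) l & forall beta, beta \in l ->
      IBr_block X lam beta].
Proof.
move=> irrchi; have [n [rX [irrX affX]]] := irrchi.
have /mx_irrP[n_gt0 _] := irrX; pose o := Ordinal n_gt0.
have absX : mx_absolutely_irreducible rX by apply: (largeX (fintype.subxx X)).1.
have [rA simA] := integral_form rX.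
have affA : affords (map_repr emb rA) chi.
  rewrite /affords affX; apply/ffunP => g; rewrite !ffunE; case: ifP => // gX.
  by rewrite (mxtrace_rsim simA).
have [l [dl bl]] := Brauer_decomposition (reduction_affords affA).
pose C x := \sum_(y in (x ^: X)%g) rA y.
have CE x : x \in X -> C x = (C x o o)%:M /\
    emb (C x o o) = #|(x ^: X)%g|%:R * chi x / chi 1%g.
  move=> xX; have [Q _ freeQ QA] := simA.
  have uQ : Q \in unitmx by rewrite -row_free_unit.
  have [c hc] : exists c, \sum_(y in (x ^: X)%g) rX y = c%:M.
    apply/is_scalar_mxP/(mx_abs_irr_cent_scalar absX)/centgmxP => z zX.
    rewrite mulmx_suml mulmx_sumr [RHS](reindex_inj (conjg_inj z)) /=.
    apply: eq_big => [y|y /(class_sub xX) yX].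
      by rewrite memJ_norm // (fintype.subsetP (class_norm x X)).
    by rewrite -!repr_mxM ?groupJ // conjgC.
  have Cc : map_mx emb (C x) = c%:M.
    apply: (row_free_inj freeQ);
      rewrite /= -scalar_mxC -hc mulmx_sumr raddf_sum mulmx_suml.
    by apply: eq_bigr => y /(class_sub xX) yX; apply: QA.
  have cE : emb (C x o o) = c by have /matrixP/(_ o o) := Cc; rewrite !mxE eqxx mulr1n.
  split.
    apply: emb_mx_inj.
    by rewrite [LHS]Cc -cE map_scalar_mx.
  have chi1 : chi 1%g = n%:R by rewrite affX ffunE group1 repr_mx1 mxtrace1.
  have nz1 : chi 1%g != 0 by rewrite chi1 pm_K_natr -lt0n.
  apply: (mulIf nz1); rewrite mulfVK // cE chi1 mulr_natr -mxtrace_scalar -hc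
    linear_sum.
  rewrite (eq_bigr (fun=> chi x)) => [|_ /imsetP[z zX ->]].
    by rewrite sumr_const mulr_natl.
  rewrite /= affX ffunE xX conjgE repr_mxM ?groupM ?groupV // mxtrace_mulC -repr_mxM
    ?groupM ?groupV //.
  by rewrite mulgK.
pose lam : cfunL M gT := [ffun x => if x \in X then res (C x o o) else 0].
have lamE x : x \in X -> lam x = res (C x o o) by move=> xX; rewrite ffunE xX.
exists lam, l; split=> //.
- by move=> x /negbTE xX; rewrite ffunE xX.
- split=> // x xX; exists (C x o o); split; last by rewrite lamE.
  by have [_] := CE x xX.
move=> beta /bl; apply=> x xX; rewrite lamE //.
have [/(congr1 (map_mx res))] := CE x xX; rewrite map_scalar_mx => <- _.
by rewrite raddf_sum.
Qed.

Lemma Irr_block_eq (lam mu : cfunL M gT) chi : Irr_block X lam chi ->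
  Irr_block X mu chi ->
  {in X, lam =1 mu}.
Proof.
move=> [_ hl] [_ hm] x xX; have [a [ea <-]] := hl x xX; have [b [eb <-]] := hm x xX.
by congr (res _); apply: (@pm_emb_inj p M); rewrite ea eb.
Qed.

Lemma eq_IBr_block (lam mu : cfunL M gT) beta : {in X, lam =1 mu} ->
  IBr_block X lam beta -> IBr_block X mu beta.
Proof.
move=> e [n [rX [irr aff act]]]; exists n, rX; split=> // x xX.
by rewrite act // e.
Qed.

Lemma eq_Irr_block (lam mu : cfunL M gT) chi : {in X, lam =1 mu} ->
  Irr_block X lam chi -> Irr_block X mu chi.
Proof. by move=> e [irr h]; split=> // x xX; rewrite -e //; apply: h. Qed.

(** On [p]-regular elements the trace is the reduction of the Brauer character,
    and elsewhere it is the trace of the [p']-part. *)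
Lemma affords_Brauer_trace n1 n2 (r1 : mx_representation L X n1)
    (r2 : mx_representation L X n2) phi :
    affords_Brauer r1 phi -> affords_Brauer r2 phi ->
  {in X, forall g, \tr (r1 g) = \tr (r2 g)}.
Proof.
move=> aff1 aff2 g gX;
  rewrite (trace_p' p_prime largeX r1) // (trace_p' p_prime largeX r2) //.
have gX' : (g.`_p^')%g \in X by rewrite groupX.
have [_ /(_ _ gX' (p_elt_constt _ _)) v1] := aff1.
have [_ /(_ _ gX' (p_elt_constt _ _)) v2] := aff2.
have [a1 e1 ->] := Brauer_value_trace v1; have [a2 e2 ->] := Brauer_value_trace v2.
by congr (res _); apply: (@pm_emb_inj p M); rewrite -e1 -e2.
Qed.

(** A Brauer character determines its block, because it determines the traces
    by which a class sum acts. *)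
Lemma IBr_block_eq (lam mu : cfunL M gT) beta : IBr_block X lam beta ->
  IBr_block X mu beta ->
  {in X, lam =1 mu}.
Proof.
move=> [n1 [r1 [irr1 aff1 act1]]] [n2 [r2 [irr2 aff2 act2]]] x xX.
have eqtr := affords_Brauer_trace aff1 aff2.
have abs1 : mx_absolutely_irreducible r1 by apply: (largeX (fintype.subxx X)).2.
have [k kX nzk] := abs_irr_trace_neq0 abs1.
have trE n (r : mx_representation L X n) nu : class_sums_act r nu ->
    nu x * \tr (r k) = \sum_(y in (x ^: X)%g) \tr (r (y * k)%g).
  move=> act; rewrite -mxtraceZ -mul_scalar_mx -act // mulmx_suml linear_sum.
  by apply: eq_bigr => y /(class_sub xX) yX; rewrite repr_mxM.
apply: (mulIf nzk); rewrite (trE _ _ _ act1) eqtr // (trE _ _ _ act2).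
by apply: eq_bigr => y /(class_sub xX) yX; rewrite eqtr ?groupM.
Qed.

Lemma ordinary_decomposition n (rX : mx_representation K X n) chi :
  affords rX chi -> effective (Irr M X) chi.
Proof.
elim/repr_ind: n / rX chi => [rX|n rX irr|n rX U Umod IH1 IH2] chi aff.
- exists [::]; split=> //; rewrite big_nil aff; apply/ffunP => g; rewrite !ffunE.
  by case: ifP => // _; rewrite /mxtrace big_ord0.
- by apply: effective1; exists n, rX.
have -> : chi = [ffun g => if g \in X then \tr (submod_repr Umod g) else 0] +
    [ffun g => if g \in X then \tr (factmod_repr Umod g) else 0].
  rewrite aff; apply/ffunP => g; rewrite !ffunE; case: ifP => _; last by rewrite addr0.
  by rewrite mxtrace_sub_fact_mod.
by apply: effectiveD; [apply: IH1|apply: IH2].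
Qed.

Lemma pregular_part_sum (I : Type) (r : seq I) (f : I -> cfunK M gT) :
  pregular_part (\sum_(i <- r) f i) = \sum_(i <- r) pregular_part (f i).
Proof.
apply/ffunP => g; rewrite !ffunE !sum_ffunE; case: ifP => pg.
  by apply: eq_bigr => i _; rewrite ffunE pg.
by rewrite big1 // => i _; rewrite ffunE pg.
Qed.

Lemma effective_pregular chi : Irr M X chi -> effective (IBr M X) (pregular_part chi).
Proof. by move=> /Irr_decomposition[lam [l [_ _ dl _]]]; exists l. Qed.

(** Every irreducible representation over [L] is a factor of the regular one,
    which is the reduction of the regular representation over [K]. *)
Lemma IBr_in_decomposition beta : IBr M X beta ->
  exists2 chi, Irr M X chi & (0 < mult (IBr M X) (pregular_part chi) beta)%N.
Proof.
move=> Ibeta; have [n [r [irr aff]]] := Ibeta.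
have [U [Umod sim]] := rsim_regular_factmod irr.
have freeI := IBr_free p_prime largeX.
pose rA := regular_repr A X.
pose chi : cfunK M gT := [ffun g => if g \in X then \tr (map_repr emb rA g) else 0].
have [lK [dK chiE]] : effective (Irr M X) chi by apply: (@ordinary_decomposition _
  (map_repr emb rA)).
have [phi1 aff1] := affords_Brauer_exists p_prime largeX (submod_repr Umod).
have aff2 : affords_Brauer (factmod_repr Umod) beta.
  split=> [g|g gX pg]; first exact: aff.1.
  by rewrite -(char_poly_rsim sim gX); apply: aff.2.
have affL : affords_Brauer (regular_repr L X) (phi1 + beta).
  by apply: affords_BrauerD aff1 aff2 _ => g gX _; apply: char_poly_sub_fact.
have affA : affords_Brauer (map_repr res rA) (pregular_part chi) by apply:
  reduction_affords.
have regE : pregular_part chi = phi1 + beta.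
  apply: (affords_Brauer_uniq p_prime affA affL) => g gX _.
  by rewrite /rA map_regular_repr.
have eff1 : effective (IBr M X) phi1.
  by have [l [dl _]] := Brauer_decomposition aff1; exists l.
have : (0 < mult (IBr M X) (pregular_part chi) beta)%N.
  by rewrite regE (multD _ _ eff1 (effective1 Ibeta)) // (mult1 freeI _ Ibeta) eqxx
    addn1.
rewrite chiE pregular_part_sum mult_sum // => [|psi /dK];
  last exact: effective_pregular.
move=> pos; apply: contrapT => no; move: pos; rewrite big1_seq // => psi /= /dK Ipsi.
by apply/eqP; rewrite -leqn0 leqNgt; apply/negP => h; apply: no; exists psi.
Qed.

End Reduction.

(** * Twisting, conjugating and restricting characters *)

Section Signs.

Variables (gT : finGroupType) (G H : {group gT}) (R : pzRingType).
Hypotheses (sHG : H \subset G) (iHG : #|G : H|%g = 2%N).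

Lemma index2_mul x y : x \in G -> y \in G ->
  ((x * y)%g \in H) = ((x \in H) == (y \in H)).
Proof.
move=> xG yG; have [xH|xH] := boolP (x \in H); first by rewrite groupMl.
have [yH|yH] := boolP (y \in H); first by rewrite groupMr // (negbTE xH).
have := @index2_coset _ G H y^-1%g sHG iHG; rewrite groupV => /(_ yG);
  rewrite groupV => /(_ yH x xG xH).
by rewrite invgK => ->.
Qed.

Definition index2_sign g : R := (-1) ^+ (g \notin H).

Lemma index2_sign1 : index2_sign 1%g = 1.
Proof. by rewrite /index2_sign group1. Qed.

Lemma index2_signM : {in G &, {morph index2_sign : x y / (x * y)%g >-> x * y}}.
Proof.
move=> x y xG yG; rewrite /index2_sign index2_mul // -exprD.
by case: (x \in H); case: (y \in H); rewrite //= sqrrN expr1n.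
Qed.

End Signs.

Section IndexTwo.

Variables (p : nat) (M : pmodular_system p) (gT : finGroupType) (G H : {group gT}).
Variables (eps : gT -> pmK M) (t : gT).
Hypotheses (p_prime : prime p) (p_odd : odd p) (largeG : large_enough M G).
Hypotheses (sHG : H \subset G) (iHG : #|G : H|%g = 2%N).
Hypotheses (tG : t \in G) (tH : t \notin H) (eps_sign : sign_character G H eps).
Local Notation K := (pmK M).
Local Notation A := (pmA M).
Local Notation L := (pmL M).
Local Notation emb := (pm_emb M).
Local Notation res := (pm_res M).
Local Notation cfun := (cfunK M gT).
Local Notation tw := (twist eps).
Local Notation rst := (Defs.restrict H).
Local Notation sgn := (index2_sign H).

Let largeH : large_enough M H := large_sub largeG sHG.
Let nHt : (t \in 'N(H))%g := index2_norm sHG iHG tG.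

Definition conj_fun (f : cfun) : cfun := [ffun g => f (g ^ t^-1)%g].

Lemma epsE g : g \in G -> eps g = sgn K g.
Proof.
move=> gG; case: eps_sign => e1 _ eH; rewrite /index2_sign -(eH g gG).
by case: (e1 g gG) => ->;
  rewrite ?eqxx // -subr_eq0 -opprD oppr_eq0 (pm_K_natr M 2) expr1.
Qed.

Lemma emb_sgn g : emb (sgn A g) = sgn K g.
Proof. by rewrite /index2_sign rmorphXn rmorphN rmorph1. Qed.

Lemma res_sgn g : res (sgn A g) = sgn L g.
Proof. by rewrite /index2_sign rmorphXn rmorphN rmorph1. Qed.

Lemma sgn_sqr (R : pzRingType) g : sgn R g * sgn R g = 1.
Proof. by rewrite /index2_sign; case: (g \notin H); rewrite ?mulrNN ?mulr1. Qed.

Lemma twistK (f : cfun) : (forall g, g \notin G -> f g = 0) -> tw (tw f) = f.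
Proof.
move=> supp; apply/ffunP => g; rewrite !ffunE mulrA.
have [gG|/supp->] := boolP (g \in G); last by rewrite mulr0.
by rewrite epsE // sgn_sqr mul1r.
Qed.

(** An element of odd order is a power of its square, which lies in [H]. *)
Lemma odd_order_index2 x : x \in G -> odd #[x]%g -> x \in H.
Proof.
move=> xG ox; apply: contrapT => /negP xH.
have xx : (x * x)%g \in H by rewrite (index2_sqr sHG iHG xG xH).
case/negP: xH; have <- : ((x * x) ^+ #[x].+1./2)%g = x.
  rewrite -[(x * x)%g]/(x ^+ 2)%g -expgM mul2n.
  have := odd_double_half #[x]%g.+1; rewrite /= ox /= add0n => ->.
  by rewrite expgS expg_order mulg1.
exact: groupX.
Qed.

(** This is where [p] is odd: the [p]-part of [g] has odd order. *)
Lemma p'_part_index2 g : g \in G -> ((g.`_p^')%g \in H) = (g \in H).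
Proof.
move=> gG; rewrite -{2}(consttC p g) groupMl //; apply: odd_order_index2;
  first exact: groupX.
have /p_natP[k ->] : p.-nat #[(g.`_p)%g]%g by exact: p_elt_constt.
by rewrite oddX p_odd orbT.
Qed.

Lemma twist_Irr chi : Irr M G chi -> Irr M G (tw chi).
Proof.
move=> [n [rG [irr aff]]].
exists n, (twist_repr (index2_sign1 H K) (index2_signM K sHG iHG) rG).
split; first exact: twist_repr_irr.
rewrite /affords aff; apply/ffunP => g; rewrite !ffunE; case: ifP => gG;
  last by rewrite mulr0.
by rewrite /= mxtraceZ epsE.
Qed.

Lemma affords_Brauer_twist n (rG : mx_representation L G n) phi :
    affords_Brauer rG phi ->
  affords_Brauer (twist_repr (index2_sign1 H L) (index2_signM L sHG iHG) rG) (tw phi).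
Proof.
move=> [z v]; split=> [g ng|g gG pg]; rewrite ffunE; first by rewrite z // mulr0.
have [s [hs e ->]] := v g gG pg; exists [seq sgn A g * a | a <- s]; split.
- move=> _ /mapP[a /hs an ->]; rewrite exprMn an mulr1 /index2_sign.
  have [gH|gH] := boolP (g \in H); first by rewrite expr0 expr1n.
  rewrite -exprM mul1n -signr_odd; case od : (odd _) => //.
  by rewrite (odd_order_index2 gG od) in gH.
- rewrite big_map /=;
  have es : char_poly (rG g) = \prod_(a <- map res s) ('X - a%:P) by rewrite big_map.
  rewrite /index2_sign; have [gH|gH] := boolP (g \in H).
    by rewrite expr0 scale1r e; apply: eq_bigr => a _; rewrite expr0 mul1r.
  rewrite expr1 scaleN1r (char_polyN es) big_map; apply: eq_bigr => a _.
  by rewrite expr1 mulN1r (rmorphN res).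
- by rewrite epsE // -emb_sgn -rmorphM big_map mulr_sumr.
Qed.

Lemma twist_IBr phi : IBr M G phi -> IBr M G (tw phi).
Proof.
move=> [n [rG [irr aff]]].
exists n, (twist_repr (index2_sign1 H L) (index2_signM L sHG iHG) rG).
by split; [exact: twist_repr_irr|exact: affords_Brauer_twist].
Qed.

Definition twist_block (lam : cfunL M gT) : cfunL M gT := [ffun x => sgn L x * lam x].

Lemma sgn_class (R : pzRingType) x y : y \in (x ^: G)%g -> sgn R y = sgn R x.
Proof.
move=> /imsetP[z zG ->]; rewrite /index2_sign memJ_norm //.
by have /andP[_ /fintype.subsetP] := index2_normal sHG iHG; apply.
Qed.

Lemma twist_IBr_block lam phi :
  IBr_block G lam phi -> IBr_block G (twist_block lam) (tw phi).
Proof.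
move=> [n [rG [irr aff act]]].
exists n, (twist_repr (index2_sign1 H L) (index2_signM L sHG iHG) rG); split.
- exact: twist_repr_irr.
- exact: affords_Brauer_twist.
move=> x xG; rewrite /= ffunE (eq_bigr (fun y => sgn L x *: rG y)) =>
  [|y /sgn_class-> //].
by rewrite -scaler_sumr act // scale_scalar_mx.
Qed.

Lemma twist_Irr_block lam chi :
  Irr_block G lam chi -> Irr_block G (twist_block lam) (tw chi).
Proof.
move=> [irr h]; split; first exact: twist_Irr.
move=> x xG; have [a [ea ra]] := h x xG; exists (sgn A x * a).
rewrite !rmorphM emb_sgn res_sgn ea ra !ffunE !epsE // (index2_sign1 H K) mul1r.
by split=> //; rewrite !mulrA [sgn K x * _]mulrC.
Qed.

Lemma conj_Irr (psi : cfun) : Irr M H psi -> Irr M H (conj_fun psi).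
Proof.
move=> [n [rH [irr aff]]]; exists n, (conj_repr nHt rH); split;
  first exact: conj_repr_irr.
rewrite /affords aff; apply/ffunP => g; rewrite !ffunE.
by rewrite memJ_norm // groupV.
Qed.

Lemma affords_Brauer_conj (X : {group gT}) (nXt : (t \in 'N(X))%g) n
    (rX : mx_representation L X n) phi :
  affords_Brauer rX phi -> affords_Brauer (conj_repr nXt rX) (conj_fun phi).
Proof.
move=> [z v]; have pJ g : (p^'.-elt (g ^ t^-1) = p^'.-elt g)%g by rewrite /p_elt orderJ.
split=> [g ng|g gX pg]; rewrite ffunE.
  by apply: z; rewrite memJ_norm ?groupV // pJ.
by have [||s hs] := v (g ^ t^-1)%g; rewrite ?memJ_norm ?groupV ?pJ //; exists s;
  rewrite orderJ in hs.
Qed.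

Lemma conj_IBr (psi : cfun) : IBr M H psi -> IBr M H (conj_fun psi).
Proof.
move=> [n [rH [irr aff]]]; exists n, (conj_repr nHt rH).
by split; [exact: conj_repr_irr|exact: affords_Brauer_conj].
Qed.

Lemma Irr_conjG chi : Irr M G chi -> conj_fun chi = chi.
Proof.
move=> [n [rG [irr ->]]]; apply/ffunP => g; rewrite !ffunE groupJr ?groupV //.
case: ifP => // gG; rewrite conjgE invgK repr_mxM ?groupM ?groupV // mxtrace_mulC.
by rewrite -repr_mxM ?groupM ?groupV // mulgKV.
Qed.

Lemma IBr_conjG phi : IBr M G phi -> conj_fun phi = phi.
Proof.
move=> [n [rG [irr aff]]];
  have nGt : (t \in 'N(G))%g by rewrite (fintype.subsetP (normG G)).
apply: (affords_Brauer_uniq p_prime (affords_Brauer_conj nGt aff) aff) => g gG _ /=.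
apply: (@char_poly_sim _ _ _ _ _ (rG t)) => //; first exact: repr_mx_free.
by rewrite -!repr_mxM ?groupJr ?groupV // -conjgCV.
Qed.

Lemma conj_pregular (f : cfun) : pregular_part (conj_fun f) = conj_fun (pregular_part
  f).
Proof. by apply/ffunP => g; rewrite !ffunE /p_elt orderJ. Qed.

Lemma twist_pregular (f : cfun) : pregular_part (tw f) = tw (pregular_part f).
Proof. by apply/ffunP => g; rewrite !ffunE; case: ifP; rewrite ?mulr0. Qed.

Lemma restrict_pregular (f : cfun) : pregular_part (rst f) = rst (pregular_part f).
Proof. by apply/ffunP => g; rewrite !ffunE; case: ifP => //; case: ifP. Qed.

(** The two outcomes of Clifford theory in index two, in a form common to
    ordinary and Brauer characters. *)
Definition splits (S : set cfun) (f : cfun) :=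
  (S (rst f) /\ tw f <> f) \/
  exists a, [/\ S a, S (conj_fun a), rst f = a + conj_fun a, tw f = f &
    conj_fun a <> a].

Lemma restrict_affords n (rG : mx_representation K G n) chi :
  affords rG chi -> affords (subg_repr rG sHG) (rst chi).
Proof.
rewrite /affords => ->; apply/ffunP => g; rewrite !ffunE; case: ifP => // gH.
by rewrite (fintype.subsetP sHG).
Qed.

Lemma restrict_affords_Brauer n (rG : mx_representation L G n) phi :
  affords_Brauer rG phi -> affords_Brauer (subg_repr rG sHG) (rst phi).
Proof.
move=> [z v]; split=> [g|g gH pg]; rewrite ffunE; last first.
  by rewrite gH; apply: v => //; apply: (fintype.subsetP sHG).
by case: ifP => // gH ng; apply: z; rewrite negb_and ng orbT.
Qed.

Lemma Irr_splits chi : Irr M G chi -> splits (Irr M H) chi.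
Proof.
move=> [n [rG [irr aff]]]; have affE := aff.
have [splitG _] := largeG (fintype.subxx G);
  have [splitH _] := largeH (fintype.subxx H).
have [[irrH [g [gG gH nz]]]|] := restrict_index2 sHG iHG tG tH irr splitG splitH.
  left; split; first by exists n, (subg_repr rG sHG); split=> //;
    apply: restrict_affords.
  move=> /ffunP/(_ g); rewrite aff !ffunE gG epsE // /index2_sign gH expr1 mulN1r =>
    /eqP.
  by rewrite eq_sym -addr_eq0 -mulr2n -mulr_natl mulf_eq0 pm_K_natr (negbTE nz).
case=> m [a [irra eH eG [h hH tr_neq]]]; right.
have trE h' : h' \in H -> \tr (rG h') = \tr (a h') + \tr (a (h' ^ t^-1)%g).
  move=> h'H; rewrite -(mxtrace_block _ 0 0); apply: eq_char_poly_trace.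
  by rewrite eH // char_poly_lblock.
pose psi : cfun := [ffun g => if g \in H then \tr (a g) else 0].
have Ipsi : Irr M H psi by exists m, a.
exists psi; split=> //; first exact: conj_Irr.
- apply/ffunP => g; rewrite affE !ffunE memJ_norm ?groupV //.
  case: ifP => gH; last by rewrite addr0.
  by rewrite (fintype.subsetP sHG) // trE.
- apply/ffunP => g; rewrite affE !ffunE; case: ifP => gG; last by rewrite mulr0.
  rewrite epsE // /index2_sign; have [gH|gH] := boolP (g \in H);
    first by rewrite expr0 mul1r.
  by rewrite expr1 mulN1r -linearN; apply: eq_char_poly_trace; apply: eG.
by move=> /ffunP/(_ h); rewrite !ffunE memJ_norm ?groupV // hH => /esym/eqP;
  rewrite (negbTE tr_neq).
Qed.

(** In the irreducible case [tw phi = phi] would make [phi], hence all traces,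
    vanish outside [H], where some trace is not zero. In the other case the
    twisted representation has the same characteristic polynomials as the
    original one, and equal conjugate constituents would have equal traces. *)
Lemma IBr_splits phi : IBr M G phi -> splits (IBr M H) phi.
Proof.
move=> Iphi; have [n [rG [irr aff]]] := Iphi.
have [_ splitG] := largeG (fintype.subxx G);
  have [_ splitH] := largeH (fintype.subxx H).
have affH := restrict_affords_Brauer aff.
have [[irrH [g [gG gH nz]]]|] := restrict_index2 sHG iHG tG tH irr splitG splitH.
  left; split; first by exists n, (subg_repr rG sHG).
  have g'G : (g.`_p^')%g \in G by rewrite groupX.
  have g'H : (g.`_p^')%g \notin H by rewrite p'_part_index2.
  move=> /ffunP/(_ (g.`_p^')%g);
    rewrite ffunE epsE // /index2_sign g'H expr1 mulN1r => /eqP.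
  rewrite eq_sym -addr_eq0 -mulr2n -mulr_natl mulf_eq0 pm_K_natr /= => phi0.
  have [_ /(_ _ g'G (p_elt_constt _ _)) v] := aff.
  have [b eb] := Brauer_value_trace v; rewrite -(trace_p' p_prime largeG) // => trb.
  by move: phi0 nz; rewrite eb emb_eq0 trb => /eqP->; rewrite rmorph0 eqxx.
case=> m [a [irra eH eG [h hH tr_neq]]]; right.
have [psi affa] := affords_Brauer_exists p_prime largeH a.
have affc := affords_Brauer_conj nHt affa.
have Ipsi : IBr M H psi by exists m, a.
exists psi; split=> //; first exact: conj_IBr.
- have affD : affords_Brauer (subg_repr rG sHG) (psi + conj_fun psi).
    by apply: affords_BrauerD affa affc _ => g gH _; apply: eH.
  exact: (affords_Brauer_uniq p_prime affH affD).
- apply: (affords_Brauer_uniq p_prime (affords_Brauer_twist aff) aff) => g gG _ /=.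
  rewrite /index2_sign; have [gH|gH] := boolP (g \in H); first by rewrite expr0 scale1r.
  by rewrite expr1 scaleN1r; apply: eG.
move=> e; rewrite e in affc; case/eqP: tr_neq.
exact: (affords_Brauer_trace p_prime largeH affa affc hH).
Qed.

End IndexTwo.

(** * Constituents of restrictions *)

Section CliffordPair.

Variables (p : nat) (M : pmodular_system p) (gT : finGroupType) (G H : {group gT}).
Variables (eps : gT -> pmK M) (t : gT).
Hypotheses (sHG : H \subset G) (eps_sign : sign_character G H eps).
Local Notation cfun := (cfunK M gT).
Local Notation tw := (twist eps).
Local Notation rst := (Defs.restrict H).
Local Notation conj := (conj_fun t).

Variables SG SH : set cfun.
Hypotheses (freeG : free_family SG) (freeH : free_family SH).
Hypothesis twS : forall f, SG f -> SG (tw f).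
Hypothesis suppS : forall f g, SG f -> g \notin G -> f g = 0.
Hypothesis conjS : forall f, SG f -> conj f = f.
Hypothesis splitS : forall f, SG f -> splits H eps t SH f.
Hypothesis tH : (t \in 'N(H))%g.

Definition constituent (f a : cfun) := (0 < mult SH (rst f) a)%N.

Lemma conj_funD (f g : cfun) : conj (f + g) = conj f + conj g.
Proof. by apply/ffunP => x; rewrite !ffunE. Qed.

Lemma rst_effective f : SG f -> effective SH (rst f).
Proof.
case/splitS=> [[Sf _]|[a [Sa Sca -> _ _]]]; first exact: effective1.
by apply: effectiveD; apply: effective1.
Qed.

Lemma rst_twist (f : cfun) : rst (tw f) = rst f.
Proof.
apply/ffunP => g; rewrite !ffunE; case: ifP => // gH.
by rewrite (epsE eps_sign) ?(fintype.subsetP sHG) // /index2_sign gH expr0 mul1r.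
Qed.

Lemma twist_add f : SG f -> f + tw f = rst f + rst f.
Proof.
move=> Sf; apply/ffunP => g; rewrite !ffunE; have [gG|gG] := boolP (g \in G);
  last first.
  rewrite suppS // mulr0 addr0; case: ifP => gH; last by rewrite addr0.
  by rewrite (fintype.subsetP sHG) in gG.
rewrite (epsE eps_sign) // /index2_sign; case: ifP => gH; first by rewrite expr0 mul1r.
by rewrite expr1 mulN1r subrr addr0.
Qed.

(** Compare the multiplicities of [f'] in [f + tw f] and [f' + tw f']. *)
Lemma rst_eq f f' : SG f -> SG f' -> rst f = rst f' -> f' = f \/ f' = tw f.
Proof.
move=> Sf Sf' e; have : mult SG (f + tw f) f' = mult SG (f' + tw f') f'.
  by rewrite !twist_add // e.
have [ef etf] : effective SG f /\ effective SG (tw f) by split; apply: effective1;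
  [|apply: twS].
have [ef' etf'] : effective SG f' /\ effective SG (tw f') by split; apply: effective1;
  [|apply: twS].
rewrite !multD // !mult1 //; try exact: twS.
rewrite eqxx; have [->|_] := eqVneq f f'; first by left.
by have [->|_] := eqVneq (tw f) f'; first by right.
Qed.

Lemma rst_conj f : SG f -> conj (rst f) = rst f.
Proof.
move=> Sf; apply/ffunP => g; rewrite !ffunE memJ_norm ?groupV //; case: ifP => // _.
by have /ffunP/(_ g) := conjS Sf; rewrite ffunE.
Qed.

Lemma constituentP f : SG f ->
  (tw f <> f /\ forall a, mult SH (rst f) a = (rst f == a)) \/
  exists b, [/\ tw f = f, rst f = b + conj b, conj b <> b, conj (conj b) = b &
    forall a, mult SH (rst f) a = ((b == a) + (conj b == a))%N].
Proof.
move=> Sf; case: (splitS Sf) => [[Srf ntw]|[b [Sb Scb rE twf ncb]]].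
  by left; split=> // a; rewrite mult1.
right; exists b; split=> // [|a].
  by have := rst_conj Sf; rewrite rE conj_funD addrC => /addIr.
by rewrite rE multD ?mult1 //; apply: effective1.
Qed.

Lemma constituent_mult f a : SG f -> constituent f a -> mult SH (rst f) a = 1%N.
Proof.
move=> Sf; rewrite /constituent; case: (constituentP Sf) => [[_ ->]|[b [_ _ ncb _ ->]]].
  by case: (_ == _).
by case: eqP => [<-|_]; case: eqP.
Qed.

Lemma constituent_irr f a : SG f -> tw f <> f -> constituent f a -> a = rst f.
Proof.
move=> Sf ntw; rewrite /constituent; case: (constituentP Sf) => [[_ ->]|[b [] //]].
by case: eqP => [->|].
Qed.

Lemma constituent_ntw f : SG f -> tw f <> f -> constituent f (rst f).
Proof.
move=> Sf ntw; rewrite /constituent; case: (constituentP Sf) => [[_ ->]|[b [] //]].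
by rewrite eqxx.
Qed.

Lemma constituent_tw f : SG f -> tw f = f -> exists b,
  [/\ constituent f b, constituent f (conj b), conj b <> b, conj (conj b) = b &
      forall a, constituent f a -> a = b \/ a = conj b].
Proof.
move=> Sf ftw; case: (constituentP Sf) => [[] //|[b [_ _ ncb ccb mE]]].
exists b; rewrite /constituent !mE !eqxx addnS; split=> // a; rewrite mE.
by case: eqP => [->|_]; [left|case: eqP => [->|//]; right].
Qed.

Lemma constituent_twist f a : constituent (tw f) a = constituent f a.
Proof. by rewrite /constituent rst_twist. Qed.

(** Two members of [SG] with a common constituent have the same restriction, and
    [f + eps f] is twice the restriction of [f]. *)
Lemma constituent_eq f f' a : SG f -> SG f' ->
  constituent f a -> constituent f' a -> f' = f \/ f' = tw f.
Proof.
move=> Sf Sf' fa f'a; apply: rst_eq => //; move: fa f'a; rewrite /constituent.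
case: (constituentP Sf) => [[_ ->]|[b [_ -> ncb ccb ->]]];
  case: (constituentP Sf') => [[_ ->]|[b' [_ rE' ncb' ccb' ->]]].
- by case: eqP => // -> _; case: eqP => // ->.
- case: eqP => // ra _; have ca : conj a = a by rewrite -ra rst_conj.
  rewrite rE'; case: eqP => [b'a|_]; first by rewrite b'a in ncb'.
  by case: eqP => // cb'a; move: ncb' ccb'; rewrite cb'a ca => n /n.
- move=> ba; case: eqP => // r'a _; have ca : conj a = a by rewrite -r'a rst_conj.
  move: ba; case: eqP => [ba|_]; first by rewrite ba in ncb.
  by case: eqP => // cba; move: ncb ccb; rewrite cba ca => n /n.
rewrite rE'; case: (eqVneq b a) => [ba _|_].
  case: (eqVneq b' a) => [b'a _|_]; first by rewrite ba b'a.
  by case: eqP => // cb'a _; rewrite ba -cb'a ccb' addrC.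
case: eqP => // cba _; case: (eqVneq b' a) => [b'a _|_];
  first by rewrite b'a -cba ccb addrC.
by case: eqP => // cb'a _; rewrite -ccb -ccb' cba cb'a.
Qed.

End CliffordPair.

(** * Restriction of a unitriangular basic set *)

Section BasicSet.

Variables (p : nat) (M : pmodular_system p) (gT : finGroupType) (G H : {group gT}).
Variables (eps : gT -> pmK M) (t : gT).
Variables (BB bb : set (cfunL M gT)) (B : set (cfunK M gT)) (le : rel (cfunK M gT)).
Variable Theta : cfunK M gT -> cfunK M gT.
Hypotheses (p_prime : prime p) (p_odd : odd p) (largeG : large_enough M G).
Hypotheses (sHG : H \subset G) (iHG : #|G : H|%g = 2%N).
Hypotheses (tG : t \in G) (tH : t \notin H) (eps_sign : sign_character G H eps).
Hypothesis bb_Res : Irr_blocks H bb = Res_constituents H (Irr_blocks G BB).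
Hypothesis B_basic : unitriangular_basic_set G BB B le Theta.
Hypothesis B_stable : forall chi, B chi -> B (twist eps chi).
Hypothesis Theta_equivariant : forall chi, B chi ->
     Theta (twist eps chi) = twist eps (Theta chi).

Local Notation cfun := (cfunK M gT).
Local Notation tw := (twist eps).
Local Notation rst := (Defs.restrict H).
Local Notation conj := (conj_fun t).
Local Notation hat := (@pregular_part p M gT).
Local Notation IrrG := (Irr M G).
Local Notation IrrH := (Irr M H).
Local Notation IBrG := (IBr M G).
Local Notation IBrH := (IBr M H).

Let largeH : large_enough M H := large_sub largeG sHG.
Let nHt : (t \in 'N(H))%g := index2_norm sHG iHG tG.
Let freeIrrG : free_family IrrG := Irr_free largeG.
Let freeIrrH : free_family IrrH := Irr_free largeH.
Let freeIBrG : free_family IBrG := IBr_free p_prime largeG.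
Let freeIBrH : free_family IBrH := IBr_free p_prime largeH.

Local Notation dG chi phi := (mult IBrG (hat chi) phi).
Local Notation dH psi a := (mult IBrH (hat psi) a).
Local Notation cIrr := (constituent H IrrH).
Local Notation cIBr := (constituent H IBrH).

Lemma IBr_supp_out phi g : IBrG phi -> g \notin G -> phi g = 0.
Proof. by move=> Iphi gG; apply: (IBr_supp Iphi); rewrite (negbTE gG). Qed.

Let twIrr := twist_Irr sHG iHG eps_sign.
Let twIBr := twist_IBr sHG iHG eps_sign.
Let conjIrr := fun chi => @Irr_conjG p M gT G t tG chi.
Let conjIBr := fun phi => @IBr_conjG p M gT G t p_prime tG phi.
Let splitIrr := fun chi =>
  @Irr_splits p M gT G H eps t largeG sHG iHG tG tH eps_sign chi.
Let splitIBr := fun phi =>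
  @IBr_splits p M gT G H eps t p_prime p_odd largeG sHG iHG tG tH eps_sign phi.

Lemma cIrr_eq chi chi' psi : IrrG chi -> IrrG chi' ->
  cIrr chi psi -> cIrr chi' psi -> chi' = chi \/ chi' = tw chi.
Proof.
by apply: (constituent_eq sHG eps_sign freeIrrG freeIrrH twIrr _ conjIrr splitIrr nHt)
  => f g; apply: Irr_supp.
Qed.

Lemma cIBr_eq phi phi' a : IBrG phi -> IBrG phi' ->
  cIBr phi a -> cIBr phi' a -> phi' = phi \/ phi' = tw phi.
Proof.
apply: (constituent_eq sHG eps_sign freeIBrG freeIBrH twIBr _ conjIBr splitIBr nHt) =>
  f g.
exact: IBr_supp_out.
Qed.

Lemma cIrr_twist chi psi : cIrr (tw chi) psi = cIrr chi psi.
Proof. exact: (constituent_twist sHG eps_sign). Qed.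

Lemma cIBr_twist phi a : cIBr (tw phi) a = cIBr phi a.
Proof. exact: (constituent_twist sHG eps_sign). Qed.

Lemma twIrrK chi : IrrG chi -> tw (tw chi) = chi.
Proof. by move=> Ichi; apply: (twistK eps_sign) => g; apply: Irr_supp. Qed.

Lemma twIBrK phi : IBrG phi -> tw (tw phi) = phi.
Proof. by move=> Iphi; apply: (twistK eps_sign) => g; apply: IBr_supp_out. Qed.

Lemma cIrr_Irr chi psi : IrrG chi -> cIrr chi psi -> IrrH psi.
Proof.
move=> Ichi c; apply: contrapT => nI; move: c; rewrite /constituent.
by rewrite (mult_notin freeIrrH _ nI) //; apply: (rst_effective splitIrr).
Qed.

Lemma dG_eff chi : IrrG chi -> effective IBrG (hat chi).
Proof. exact: effective_pregular. Qed.

Lemma dH_eff psi : IrrH psi -> effective IBrH (hat psi).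
Proof. exact: effective_pregular. Qed.

Lemma dG_IBr chi phi : IrrG chi -> (0 < dG chi phi)%N -> IBrG phi.
Proof.
move=> Ichi c; apply: contrapT => nI; move: c.
by rewrite (mult_notin freeIBrG _ nI) //; apply: dG_eff.
Qed.

Lemma dG_twist_le chi phi : IrrG chi -> IBrG phi ->
  (dG chi phi <= dG (tw chi) (tw phi))%N.
Proof.
move=> Ichi Iphi; have [l [lI hE]] := dG_eff Ichi.
have dl : decomposes IBrG (hat chi) l by split.
have dtl : decomposes IBrG (hat (tw chi)) (map tw l).
  split; first by move=> _ /mapP[f /lI If ->]; apply: twIBr.
  rewrite twist_pregular hE big_map; apply/ffunP => g;
    rewrite ffunE !sum_ffunE mulr_sumr.
  by apply: eq_bigr => f _; rewrite ffunE.
rewrite (mult_count freeIBrG _ dl) (mult_count freeIBrG _ dtl) count_map.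
by apply: sub_count => f /= /eqP->.
Qed.

Lemma dG_twist chi phi : IrrG chi -> IBrG phi -> dG (tw chi) (tw phi) = dG chi phi.
Proof.
move=> Ichi Iphi; apply/eqP; rewrite eqn_leq dG_twist_le // andbT.
by have := dG_twist_le (twIrr Ichi) (twIBr Iphi); rewrite twIrrK // twIBrK.
Qed.

Lemma dH_conj psi a : IrrH psi -> (dH psi a <= dH (conj psi) (conj a))%N.
Proof.
move=> Ipsi; have [l [lI hE]] := dH_eff Ipsi.
have dl : decomposes IBrH (hat psi) l by split.
have dtl : decomposes IBrH (hat (conj psi)) (map conj l).
  split; first by move=> _ /mapP[f /lI If ->]; apply: (conj_IBr sHG iHG tG).
  rewrite conj_pregular hE big_map; apply/ffunP => g; rewrite ffunE !sum_ffunE.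
  by apply: eq_bigr => f _; rewrite ffunE.
rewrite (mult_count freeIBrH _ dl) (mult_count freeIBrH _ dtl) count_map.
by apply: sub_count => f /= /eqP->.
Qed.

(** Restriction commutes with taking the [p]-regular part; comparing the
    multiplicities of [a] in both orders gives this identity. *)
Lemma decomposition_restrict chi r l a :
    decomposes IrrH (rst chi) r -> decomposes IBrG (hat chi) l ->
  (\sum_(psi <- r) dH psi a = \sum_(phi <- l) mult IBrH (rst phi) a)%N.
Proof.
move=> [rI rE] [lI lE].
rewrite -(mult_sum freeIBrH) => [|psi /rI]; last exact: dH_eff.
rewrite -(mult_sum freeIBrH) => [|phi /lI]; last exact: (rst_effective splitIBr).
congr (mult _ _ _); rewrite -pregular_part_sum -rE restrict_pregular lE.
apply/ffunP => g; rewrite !ffunE !sum_ffunE; case: ifP => gH.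
  by apply: eq_bigr => f _; rewrite ffunE gH.
by rewrite big1 // => f _; rewrite ffunE gH.
Qed.

Lemma sum_seq_gt0 (I : eqType) (r : seq I) (F : I -> nat) :
  (0 < \sum_(i <- r) F i)%N -> exists2 i, i \in r & (0 < F i)%N.
Proof.
move=> pos; apply: contrapT => no; move: pos; rewrite big1_seq // => i /= ir.
by apply/eqP; rewrite -leqn0 leqNgt; apply/negP => h; apply: no; exists i.
Qed.

Lemma sum_seq_ge (I : eqType) (r : seq I) (F : I -> nat) i :
  i \in r -> (F i <= \sum_(j <- r) F j)%N.
Proof. by move=> ir; rewrite (big_rem i) //= leq_addr. Qed.

(** In [decomposition_restrict] a positive left-hand side forces a positive
    term on the right. *)
Lemma constituent_up chi psi a : IrrG chi -> cIrr chi psi -> (0 < dH psi a)%N ->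
  exists2 phi, (0 < dG chi phi)%N & cIBr phi a.
Proof.
move=> Ichi c d; have [r dr] := rst_effective splitIrr Ichi; have [l dl] := dG_eff Ichi.
have := decomposition_restrict a dr dl.
have /sum_seq_ge h : psi \in r by rewrite -(mult_gt0 freeIrrH _ dr).
move=> e; have : (0 < \sum_(phi <- l) mult IBrH (rst phi) a)%N.
  by rewrite -e; apply: leq_trans d (h (fun f => dH f a)).
move=> /sum_seq_gt0[phi phil m0]; exists phi => //.
by rewrite (mult_gt0 freeIBrG _ dl).
Qed.

Lemma B_Irr chi : B chi -> IrrG chi.
Proof. by case: B_basic => sB _ _ _ _ /sB[lam _ []]. Qed.

Lemma Theta_IBrs chi : B chi -> IBr_blocks G BB (Theta chi).
Proof. by case: B_basic => _ _ [Tfun _ _] _ _ Bchi; apply: (Tfun chi Bchi). Qed.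

Lemma IBrs_IBr phi : IBr_blocks G BB phi -> IBrG phi.
Proof. by case=> lam _; apply: IBr_blockW. Qed.

Lemma Theta_IBr chi : B chi -> IBrG (Theta chi).
Proof. by move=> /Theta_IBrs/IBrs_IBr. Qed.

Lemma decnumE chi phi : IrrG chi -> IBrG phi ->
  decomposition_number G chi phi = (dG chi phi)%:R.
Proof. by move=> Ichi Iphi; apply: coefficient_mult => //; apply: dG_eff. Qed.

Lemma Theta_inj chi chi' : B chi -> B chi' -> Theta chi = Theta chi' -> chi = chi'.
Proof. by case: B_basic => _ _ [_ Tinj _] _ _ *; apply: Tinj; rewrite ?inE. Qed.

Lemma Theta_surj phi : IBr_blocks G BB phi -> exists2 chi, B chi & Theta chi = phi.
Proof. by case: B_basic => _ _ [_ _ Tsurj] _ _ /Tsurj[chi]; exists chi. Qed.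

Lemma Theta_diag chi : B chi -> dG chi (Theta chi) = 1%N.
Proof.
move=> Bchi; case: B_basic => _ _ _ diag _; apply: (@natK_inj p M).
by rewrite -decnumE ?diag //; [apply: B_Irr|apply: Theta_IBr].
Qed.

Lemma Theta_tri chi chi' : Irr_blocks G BB chi -> B chi' ->
  (0 < dG chi (Theta chi'))%N ->
  le chi chi'.
Proof.
move=> Ichi Bchi' d; apply: contrapT => /negP nle.
have IrrGchi : IrrG chi by case: Ichi => lam _ [].
case: B_basic => _ _ _ _ /(_ _ _ _ (Theta_IBrs Bchi') Ichi Bchi' erefl nle).
rewrite decnumE //; last exact: Theta_IBr.
by move/eqP; rewrite pm_K_natr -leqn0 leqNgt d.
Qed.

Lemma leB_anti chi chi' : Irr_blocks G BB chi -> Irr_blocks G BB chi' ->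
  le chi chi' -> le chi' chi -> chi = chi'.
Proof.
case: B_basic => _ [_ anti _ _] _ _ _ I1 I2 l1 l2.
by apply: anti; rewrite ?inE // l1.
Qed.

Lemma B_Irrs chi : B chi -> Irr_blocks G BB chi.
Proof. by case: B_basic => sB _ _ _ _ /sB. Qed.

(** If this number were positive, unitriangularity would give both
    [chi <= tw chi] and [tw chi <= chi]. *)
Lemma Theta_diag_twist chi : B chi -> tw (Theta chi) <> Theta chi ->
  dG chi (tw (Theta chi)) = 0%N.
Proof.
move=> Bchi nst; apply/eqP; rewrite -leqn0 leqNgt; apply/negP => d.
have Ichi := B_Irr Bchi; have Btw := B_stable Bchi.
have le1 : le chi (tw chi) by apply: Theta_tri; rewrite ?Theta_equivariant //;
  apply: B_Irrs.
have le2 : le (tw chi) chi.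
  apply: Theta_tri => //; first exact: B_Irrs.
  by rewrite -(twIBrK (Theta_IBr Bchi)) dG_twist //; apply: twIBr; apply: Theta_IBr.
apply: nst; rewrite -Theta_equivariant //; congr Theta; apply: leB_anti => //;
  exact: B_Irrs.
Qed.

(** On the right of [decomposition_restrict] only [phi = Theta chi] contributes:
    the other character over [a], if any, is [tw (Theta chi)], which does not
    occur in [chi]. *)
Lemma decomposition_B chi r a : B chi -> cIBr (Theta chi) a ->
  decomposes IrrH (rst chi) r -> (\sum_(psi <- r) dH psi a = 1)%N.
Proof.
move=> Bchi c dr; have Ichi := B_Irr Bchi; have IT := Theta_IBr Bchi.
have [l dl] := dG_eff Ichi.
rewrite (decomposition_restrict a dr dl) -(Theta_diag Bchi) (mult_count freeIBrG _ dl).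
rewrite -sum1_count [RHS]big_mkcond; apply: eq_big_seq => phi phil /=.
have Iphi : IBrG phi by case: dl => lI _; apply: lI.
have [->|nT] := eqVneq phi (Theta chi);
  first exact: (constituent_mult freeIBrH conjIBr splitIBr nHt IT c).
apply/eqP; rewrite -leqn0 leqNgt; apply/negP => c'.
case: (cIBr_eq IT Iphi c c') => e; first by rewrite e eqxx in nT.
have : (0 < dG chi phi)%N by rewrite (mult_gt0 freeIBrG _ dl).
rewrite e Theta_diag_twist // => e'; by rewrite e e' eqxx in nT.
Qed.

(** A sum of natural numbers equal to [1] has a single nonzero term. *)
Lemma B_below chi a : B chi -> cIBr (Theta chi) a ->
  exists psi, [/\ cIrr chi psi, dH psi a = 1%N &
    forall psi', cIrr chi psi' -> (0 < dH psi' a)%N -> psi' = psi].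
Proof.
move=> Bchi c; have [r dr] := rst_effective splitIrr (B_Irr Bchi).
have sum1 := decomposition_B Bchi c dr.
have [psi psir d] : exists2 psi, psi \in r & (0 < dH psi a)%N by apply: sum_seq_gt0;
  rewrite sum1.
have cE f : cIrr chi f = (f \in r) by rewrite /constituent (mult_gt0 freeIrrH _ dr).
exists psi; split=> [||f]; first by rewrite cE.
  by apply/eqP; rewrite eqn_leq d andbT -sum1 (sum_seq_ge (fun f => dH f a)).
rewrite cE => fr df; apply: contrapT => /eqP nf.
move: sum1; rewrite (big_rem psi) //= (big_rem f) /=; last first.
  have : f \in psi :: rem psi r by rewrite -(perm_mem (perm_to_rem psir)).
  by rewrite inE (negbTE nf).
by move: d df; case: (dH psi a) => // m _; case: (dH f a) => // k _;
  rewrite addSn addnS.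
Qed.

(** If the restrictions of [chi] and [Theta chi] are irreducible this is
    [B_below]. Otherwise both have two constituents exchanged by conjugation,
    which preserves decomposition numbers, so the two constituents of
    [Theta chi] occur in different constituents of [chi]. *)
Lemma B_above chi psi : B chi -> cIrr chi psi -> exists a,
  [/\ cIBr (Theta chi) a, (0 < dH psi a)%N &
      forall a', cIBr (Theta chi) a' -> (0 < dH psi a')%N -> a' = a].
Proof.
move=> Bchi c; have Ichi := B_Irr Bchi; have IT := Theta_IBr Bchi.
have [twc|ntwc] := pselect (tw chi = chi); last first.
  have ntwT : tw (Theta chi) <> Theta chi.
    by rewrite -Theta_equivariant // => /(Theta_inj (B_stable Bchi) Bchi).
  have cT := constituent_ntw freeIBrH conjIBr splitIBr nHt IT ntwT.
  have [psi' [c' d' _]] := B_below Bchi cT.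
  have psiE := constituent_irr freeIrrH conjIrr splitIrr nHt Ichi ntwc c.
  have psiE' := constituent_irr freeIrrH conjIrr splitIrr nHt Ichi ntwc c'.
  exists (rst (Theta chi)); split=> [//||a' ca' _].
    by rewrite psiE -psiE' d'.
  exact: (constituent_irr freeIBrH conjIBr splitIBr nHt IT ntwT ca').
have twT : tw (Theta chi) = Theta chi by rewrite -Theta_equivariant ?twc.
have [a [ca cca nca cca_a aE]] := constituent_tw freeIBrH conjIBr splitIBr nHt IT twT.
have [f [cf ccf ncf ccf_f fE]] := constituent_tw freeIrrH conjIrr splitIrr nHt Ichi twc.
have [psi1 [c1 d1 u1]] := B_below Bchi ca.
have [psi2 [c2 d2 u2]] := B_below Bchi cca.
have conj_psi g : cIrr chi g -> cIrr chi (conj g) /\ conj g <> g /\ conj (conj g) = g.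
  case/fE=> ->; first by [].
  by rewrite ccf_f; split=> //; split=> // /esym.
have IcE g : cIrr chi g -> IrrH g by apply: cIrr_Irr.
have psi2E : psi2 = conj psi1.
  apply/esym/u2; first by case: (conj_psi _ c1).
  by apply: leq_trans (dH_conj a (IcE _ c1)); rewrite d1.
have npsi : psi2 <> psi1 by rewrite psi2E; case: (conj_psi _ c1) => _ [].
have psiE : psi = psi1 \/ psi = psi2.
  have [cc1 [_ ccc1]] := conj_psi _ c1; rewrite psi2E.
  have [->|->] := fE _ c; have [e1|e1] := fE _ c1; rewrite ?e1 ?ccf_f; auto.
case: psiE => e; [exists a | exists (conj a)]; split; rewrite ?e ?d1 ?d2 //.
  by move=> a' /aE[-> //|->] d'; case: npsi; apply/esym/u2.
by move=> a' /aE[->|-> //] d'; case: npsi; apply/u1.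
Qed.

(** All constituents of the reduction of [chi] lie in the block in which
    [Irr_decomposition] places [chi], and this block is unique on [X]. *)
Lemma block_link (X : {group gT}) (lam : cfunL M gT) chi phi : large_enough M X ->
  Irr_block X lam chi -> (0 < mult (IBr M X) (hat chi) phi)%N -> IBr_block X lam phi.
Proof.
move=> largeX blk; have [Ichi _] := blk.
have [mu [l [_ blk' dl h]]] := Irr_decomposition p_prime largeX Ichi.
rewrite (mult_gt0 (IBr_free p_prime largeX) _ dl) => /h.
exact: eq_IBr_block (Irr_block_eq blk' blk).
Qed.

Lemma block_link_inv (X : {group gT}) (lam : cfunL M gT) chi phi : large_enough M X ->
  Irr M X chi -> IBr_block X lam phi -> (0 < mult (IBr M X) (hat chi) phi)%N ->
  Irr_block X lam chi.
Proof.
move=> largeX Ichi blk;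
  have [mu [l [_ blk' dl h]]] := Irr_decomposition p_prime largeX Ichi.
rewrite (mult_gt0 (IBr_free p_prime largeX) _ dl) => /h blk''.
exact: eq_Irr_block (IBr_block_eq p_prime largeX blk'' blk) blk'.
Qed.

Lemma Irr_has_IBr chi : IrrG chi -> exists phi, (0 < dG chi phi)%N.
Proof.
move=> Ichi; have [l dl] := dG_eff Ichi; case: l dl => [|phi l] dl; last first.
  by exists phi; rewrite (mult_gt0 freeIBrG _ dl) mem_head.
have [_ /ffunP/(_ 1%g)] := dl; rewrite big_nil !ffunE p_elt1.
have [n [rG [/mx_irrP[n0 _] ->]]] := Ichi;
  rewrite ffunE group1 repr_mx1 mxtrace1 => /eqP.
by rewrite pm_K_natr eqn0Ngt n0.
Qed.

(** A block of [BB] contains some [Theta chi'], so its twist contains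
    [Theta (eps chi')] and is again in [BB]. *)
Lemma Irrs_twist chi : Irr_blocks G BB chi -> Irr_blocks G BB (tw chi).
Proof.
move=> [lam BBlam blk]; have [Ichi _] := blk.
have [phi d] := Irr_has_IBr Ichi; have blkphi := block_link largeG blk d.
have [chi' Bchi' phiE] : exists2 chi', B chi' & Theta chi' = phi.
  by apply: Theta_surj; exists lam.
have [mu BBmu blkmu] := Theta_IBrs (B_stable Bchi').
exists mu => //; have blktw := twist_IBr_block sHG iHG eps_sign blkphi.
rewrite Theta_equivariant // phiE in blkmu.
apply: eq_Irr_block (IBr_block_eq p_prime largeG blktw blkmu) _.
exact: (twist_Irr_block sHG iHG eps_sign blk).
Qed.

Lemma Res_constituentsE (S : set cfun) psi : S `<=` IrrG ->
  Res_constituents H S psi <-> exists2 chi, S chi & cIrr chi psi.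
Proof.
move=> SI; split=> [[Ipsi [chi Schi]]|[chi Schi c]].
  rewrite coefficient_mult //; last by apply: (rst_effective splitIrr); apply: SI.
  by rewrite pm_K_natr -lt0n => c; exists chi.
have Ipsi := cIrr_Irr (SI _ Schi) c; split=> //; exists chi => //.
rewrite coefficient_mult //; last by apply: (rst_effective splitIrr); apply: SI.
by rewrite pm_K_natr -lt0n.
Qed.

Lemma Irrs_Irr : Irr_blocks G BB `<=` IrrG.
Proof. by move=> chi [lam _ []]. Qed.

Lemma Irrs_above psi : Irr_blocks H bb psi <-> exists2 chi, Irr_blocks G BB chi &
  cIrr chi psi.
Proof. by rewrite bb_Res; apply: Res_constituentsE; apply: Irrs_Irr. Qed.

Lemma BresE psi : Res_constituents H B psi <-> exists2 chi, B chi & cIrr chi psi.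
Proof. by apply: Res_constituentsE => chi; apply: B_Irr. Qed.

Lemma Bres_Irrs psi : Res_constituents H B psi -> Irr_blocks H bb psi.
Proof. by move=> /BresE[chi Bchi c]; apply/Irrs_above; exists chi => //;
  apply: B_Irrs. Qed.

Lemma IrrsH_Irr psi : Irr_blocks H bb psi -> IrrH psi.
Proof. by move=> [lam _ []]. Qed.

(** The graph of the bijection for [H]. *)
Definition matched psi a :=
  exists chi, [/\ B chi, cIrr chi psi, cIBr (Theta chi) a & (0 < dH psi a)%N].

Lemma B_orbit_same chi chi' psi a : B chi -> B chi' -> chi' = chi \/ chi' = tw chi ->
  (cIrr chi' psi = cIrr chi psi) * (cIBr (Theta chi') a = cIBr (Theta chi) a).
Proof.
move=> Bchi Bchi' [->|->] //.
by rewrite cIrr_twist Theta_equivariant // cIBr_twist.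
Qed.

Lemma matched_fun psi a a' : matched psi a -> matched psi a' -> a = a'.
Proof.
move=> [chi [Bchi c ca d]] [chi' [Bchi' c' ca' d']].
have same := cIrr_eq (B_Irr Bchi) (B_Irr Bchi') c c'.
rewrite (B_orbit_same psi a' Bchi Bchi' same).2 in ca'.
by have [b [_ _ u]] := B_above Bchi c; rewrite (u a) // (u a').
Qed.

Lemma Theta_orbit chi chi' a : B chi -> B chi' -> cIBr (Theta chi) a ->
  cIBr (Theta chi') a ->
  chi' = chi \/ chi' = tw chi.
Proof.
move=> Bchi Bchi' c c'; have [e|e] := cIBr_eq (Theta_IBr Bchi) (Theta_IBr Bchi') c c'.
  by left; apply: Theta_inj.
by right; apply: Theta_inj => //; [apply: B_stable|rewrite Theta_equivariant].
Qed.

Lemma matched_inj psi psi' a : matched psi a -> matched psi' a -> psi = psi'.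
Proof.
move=> [chi [Bchi c ca d]] [chi' [Bchi' c' ca' d']].
have same := Theta_orbit Bchi Bchi' ca ca'.
rewrite (B_orbit_same psi' a Bchi Bchi' same).1 in c'.
by have [f [_ _ u]] := B_below Bchi ca; rewrite (u psi) // (u psi').
Qed.

Lemma matched_IBrs psi a : matched psi a -> IBr_blocks H bb a.
Proof.
move=> [chi [Bchi c ca d]]; have /Bres_Irrs[mu bbmu blk] : Res_constituents H B psi.
  by apply/BresE; exists chi.
by exists mu => //; apply: block_link blk d.
Qed.

(** Going up: [a] occurs in some [psi] of its block, [psi] lies below some [chi]
    in the blocks of [G], and then [a] lies below some constituent [phi] of the
    reduction of [chi]; this [phi] is in the image of [Theta]. *)
Lemma matched_surj a : IBr_blocks H bb a -> exists psi, matched psi a.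
Proof.
move=> [mu bbmu blk];
  have [psi Ipsi d] := IBr_in_decomposition p_prime largeH (IBr_blockW blk).
have /Irrs_above[chi chiBB c] : Irr_blocks H bb psi.
  by exists mu => //; apply: block_link_inv largeH Ipsi blk d.
have [phi dphi ca] := constituent_up (Irrs_Irr chiBB) c d.
have [chi1 Bchi1 phiE] : exists2 chi1, B chi1 & Theta chi1 = phi.
  by apply: Theta_surj; case: chiBB => lam BBlam blk'; exists lam => //;
    apply: block_link blk' dphi.
rewrite -phiE in ca; have [psi1 [c1 d1 _]] := B_below Bchi1 ca.
by exists psi1, chi1; rewrite d1.
Qed.

Definition ThetaH psi : cfun := xget 0 [set a | matched psi a].

Lemma ThetaHP psi : Res_constituents H B psi -> matched psi (ThetaH psi).
Proof.
move=> /BresE[chi Bchi c]; have [a [ca d _]] := B_above Bchi c.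
have m : matched psi a by exists chi.
by rewrite /ThetaH; apply: (xgetPex 0 (P := [set a | matched psi a])); exists a.
Qed.

Lemma ThetaH_bij : set_bij (Res_constituents H B) (IBr_blocks H bb) ThetaH.
Proof.
split=> [psi Bpsi|psi psi' |a /matched_surj[psi m]].
- exact: matched_IBrs (ThetaHP Bpsi).
- rewrite !inE => Bpsi Bpsi' e; apply: matched_inj (ThetaHP Bpsi) _.
  by rewrite e; apply: ThetaHP.
have Bpsi : Res_constituents H B psi.
  by apply/BresE; case: m => chi [Bchi c _ _]; exists chi.
by exists psi => //; apply: matched_fun (ThetaHP Bpsi) m.
Qed.

Lemma matched_mult psi a : matched psi a -> dH psi a = 1%N.
Proof.
move=> [chi [Bchi c ca d]]; have [f [_ d1 u]] := B_below Bchi ca.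
by rewrite (u psi).
Qed.

(** Characters of [H] are compared through the smaller of the two (possibly
    equal) characters [chi] and [eps chi] of [G] above them, ties being broken
    by their positions in an enumeration. *)
Definition over psi : cfun :=
  xget 0 [set chi | [/\ Irr_blocks G BB chi, cIrr chi psi & le chi (tw chi)]].

Lemma leB_total chi chi' : Irr_blocks G BB chi -> Irr_blocks G BB chi' ->
  le chi chi' || le chi' chi.
Proof. by case: B_basic => _ [_ _ _ tot] _ _ _ I1 I2; apply: tot; rewrite inE. Qed.

Lemma leB_trans chi1 chi2 chi3 :
  Irr_blocks G BB chi1 -> Irr_blocks G BB chi2 -> Irr_blocks G BB chi3 ->
  le chi1 chi2 -> le chi2 chi3 -> le chi1 chi3.
Proof.
case: B_basic => _ [_ _ tr _] _ _ _ I1 I2 I3; apply: tr; by rewrite inE.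
Qed.

Lemma overP psi : Irr_blocks H bb psi ->
  [/\ Irr_blocks G BB (over psi), cIrr (over psi) psi & le (over psi) (tw (over psi))].
Proof.
move=> /Irrs_above[chi chiBB c].
suff ex : exists chi, [/\ Irr_blocks G BB chi, cIrr chi psi & le chi (tw chi)].
  exact: (xgetPex 0 ex).
have twBB := Irrs_twist chiBB.
case/orP: (leB_total chiBB twBB) => l; first by exists chi.
by exists (tw chi); rewrite cIrr_twist twIrrK //; apply: Irrs_Irr.
Qed.

Definition leH (e : seq cfun) psi psi' :=
  if over psi == over psi' then (index psi e <= index psi' e)%N
  else le (over psi) (over psi').

Lemma leH_total_order e : (forall psi, IrrH psi -> psi \in e) ->
  total_order_on (Irr_blocks H bb) (leH e).
Proof.
move=> eI; split.
- by move=> psi _; rewrite /leH eqxx.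
- move=> psi psi'; rewrite !inE => I I'; rewrite /leH eq_sym; case: eqVneq => [o|no].
    rewrite -eqn_leq => /eqP ei.
    by rewrite -(nth_index 0 (eI _ (IrrsH_Irr I))) ei nth_index // eI //;
      apply: IrrsH_Irr.
  move=> /andP[l l']; case/eqP: no; have [o1 _ _] := overP I; have [o2 _ _] := overP I'.
  exact: leB_anti.
- move=> psi2 psi1 psi3; rewrite !inE => I2 I1 I3; rewrite /leH.
  have [o1 _ _] := overP I1; have [o2 _ _] := overP I2; have [o3 _ _] := overP I3.
  have [e12|n12] := eqVneq (over psi1) (over psi2);
    have [e23|n23] := eqVneq (over psi2) (over psi3).
  + by rewrite e12 e23 eqxx; apply: leq_trans.
  + by rewrite e12 (negbTE n23).
  + by rewrite -e23 (negbTE n12).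
  move=> l12 l23; have [e13|_] := eqVneq; last exact: leB_trans l12 l23.
  by rewrite e13 in l12 n12; case/eqP: n12; apply: leB_anti.
move=> psi psi'; rewrite !inE => I I'; rewrite /leH eq_sym; case: eqVneq => [o|no].
  exact: leq_total.
by apply: leB_total; [have [] := overP I|have [] := overP I'].
Qed.

(** Some character [Theta chi1] over [a] occurs in the character [over psi], so
    [over psi <= chi1]; twisting, [tw (over psi) <= tw chi1]. As [over psi0] is
    [chi1] or [tw chi1], and [over psi <= tw (over psi)], both cases give
    [over psi <= over psi0]. In case of equality [psi] and [psi0] lie below the
    same member of [B] and contain [a], so they coincide. *)
Lemma leH_tri e psi psi0 a : Irr_blocks H bb psi -> Irr_blocks H bb psi0 ->
  matched psi0 a -> (0 < dH psi a)%N -> leH e psi psi0.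
Proof.
move=> Ipsi Ipsi0 [chi0 [Bchi0 c0 ca0 d0]] d.
have [oBB oc ole] := overP Ipsi; have [oBB0 oc0 _] := overP Ipsi0.
have [phi dphi ca] := constituent_up (Irrs_Irr oBB) oc d.
have Iphi := dG_IBr (Irrs_Irr oBB) dphi.
have [chi1 [Bchi1 phiE]] : exists chi1, B chi1 /\ phi = Theta chi1.
  have [->|->] := cIBr_eq (Theta_IBr Bchi0) Iphi ca0 ca; first by exists chi0.
  by exists (tw chi0); rewrite Theta_equivariant //; split=> //; apply: B_stable.
rewrite {}phiE in dphi ca Iphi.
have same := Theta_orbit Bchi1 Bchi0 ca ca0.
have c1 : cIrr chi1 psi0 by rewrite -(B_orbit_same psi0 a Bchi1 Bchi0 same).1.
have le1 := Theta_tri oBB Bchi1 dphi.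
have le2 : le (tw (over psi)) (tw chi1).
  apply: Theta_tri; [exact: Irrs_twist|exact: B_stable|].
  by rewrite Theta_equivariant // dG_twist //; apply: Irrs_Irr.
have over0 : over psi0 = chi1 \/ over psi0 = tw chi1.
  exact: cIrr_eq (B_Irr Bchi1) (Irrs_Irr oBB0) c1 oc0.
rewrite /leH; have [o|no] := eqVneq; last first.
  case: over0 => ->; first exact: le1.
  apply: leB_trans ole le2 => //; first exact: Irrs_twist.
  by apply: B_Irrs; apply: B_stable.
have c1psi : cIrr chi1 psi.
  by move: oc; rewrite o; case: over0 => ->; rewrite ?cIrr_twist.
have [f [_ _ u]] := B_below Bchi1 ca.
by rewrite (u psi) // (u psi0).
Qed.

Lemma decnumHE psi a : IrrH psi -> IBrH a ->
  decomposition_number H psi a = (dH psi a)%:R.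
Proof. by move=> Ipsi Ia; apply: coefficient_mult => //; apply: dH_eff. Qed.

Lemma IBrsH_IBr a : IBr_blocks H bb a -> IBrH a.
Proof. by case=> mu _; apply: IBr_blockW. Qed.

Lemma restrict_basic_set : exists (le' : rel cfun) (Theta' : cfun -> cfun),
  unitriangular_basic_set H bb (Res_constituents H B) le' Theta'.
Proof.
have [r _ rI] := free_finite freeIrrH.
exists (leH r), ThetaH; split.
- exact: Bres_Irrs.
- by apply: leH_total_order => psi /rI.
- exact: ThetaH_bij.
- move=> psi Bpsi; have m := ThetaHP Bpsi; have Ipsi := IrrsH_Irr (Bres_Irrs Bpsi).
  by rewrite decnumHE ?(matched_mult m) //; apply: IBrsH_IBr (matched_IBrs m).
move=> a psi psi0 Ia Ipsi Bpsi0 aE nle; have m := ThetaHP Bpsi0; rewrite aE in m.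
rewrite decnumHE; [|exact: IrrsH_Irr|exact: IBrsH_IBr].
apply/eqP; rewrite pm_K_natr -leqn0 leqNgt; apply/negP => d.
by case/negP: nle; apply: leH_tri m d => //; apply: Bres_Irrs.
Qed.

End BasicSet.

Theorem theorem12 (p : nat) (M : pmodular_system p) (gT : finGroupType)
  (G H : {group gT}) (eps : gT -> pmK M)
  (BB bb : set (cfunL M gT)) (B : set (cfunK M gT)) (le : rel (cfunK M gT))
  (Theta : cfunK M gT -> cfunK M gT)
  (p_prime : prime p) (p_odd : odd p) (p_dvd : (p %| #|G|)%N)
  (M_large : large_enough M G)
  (H_sub : H \subset G) (H_index : #|G : H|%g = 2%N)
  (eps_sign : sign_character G H eps)
  (BB_blocks : BB `<=` pblocks M G) (bb_blocks : bb `<=` pblocks M H)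
  (BB_covers_bb : covers G H BB bb)
  (bb_Res : Irr_blocks H bb = Res_constituents H (Irr_blocks G BB))
  (B_basic : unitriangular_basic_set G BB B le Theta)
  (B_stable : forall chi, B chi -> B (twist eps chi))
  (Theta_equivariant : forall chi, B chi ->
     Theta (twist eps chi) = twist eps (Theta chi)) :
  exists (le' : rel (cfunK M gT)) (Theta' : cfunK M gT -> cfunK M gT),
    unitriangular_basic_set H bb (Res_constituents H B) le' Theta'.
Proof.
have /fintype.subsetPn[t tG tH] : ~~ (G \subset H).
  by rewrite -indexg_eq1 H_index.
exact: (restrict_basic_set p_prime p_odd M_large H_sub H_index tG tH eps_sign
  bb_Res B_basic B_stable Theta_equivariant).
Qed.
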